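(* Let $n\ge3$, $m\ge2$ and $1\le j\le m-1$. The map $R_j^\epsilon:\mathcal{Q}_\epsilon\to\mathcal{Q}_\epsilon$ (defined on the generators $q_{j',i}$) is a morphism of skew fields. Thus, writing $q'_{j,i}=R_j^\epsilon(q_{j,i})$ and $q'_{j+1,i}=R_j^\epsilon(q_{j+1,i})$, with $\mathbf{q}'_j=(q'_{j,i})_i$, $\mathbf{q}'_{j+1}=(q'_{j+1,i})_i$, the elements $(\mathbf{q}_1,\dots,\mathbf{q}_{j-1},\mathbf{q}'_j,\mathbf{q}'_{j+1},\mathbf{q}_{j+2},\dots,\mathbf{q}_m)$ satisfy identical commutation relations to $(\mathbf{q}_1,\dots,\mathbf{q}_m)$.
   Context: Second indices are taken in $\mathbb{Z}/n\mathbb{Z}$, and $\epsilon$ is a central indeterminate. For $k\in\mathbb{Z}/n\mathbb{Z}$ let $S_k$ (the $k$-th snake path) be the set of $q_{j,i}$ with $i+j\equiv1+k\pmod n$. $\mathcal{Q}_\epsilon=\mathbb{Q}_\epsilon\langle\mathbf{q}_1,\dots,\mathbf{q}_m\rangle$, $\mathbf{q}_j=(q_{j,i})_{i}$, is the skew field of fractions of the quantum torus over $\mathbb{Z}[\epsilon,\epsilon^{-1}]$ generated by the $q_{j,i}^{\pm1}$ ($1\le j\le m$, $i\in\mathbb{Z}/n\mathbb{Z}$) with relations $$q_{j,i}q_{j',i'}=\begin{cases}\epsilon\,q_{j',i'}q_{j,i}&q_{j,i}\in S_{k+1},\ q_{j',i'}\in S_k,\ j\le j',\\ \epsilon^{-1}q_{j',i'}q_{j,i}&q_{j,i}\in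 S_{k+1},\ q_{j',i'}\in S_k,\ j>j',\\ \epsilon^{-2}q_{j',i'}q_{j,i}&q_{j,i},q_{j',i'}\in S_k,\ j<j',\\ \epsilon^{2}q_{j',i'}q_{j,i}&q_{j,i},q_{j',i'}\in S_k,\ j>j',\\ q_{j',i'}q_{j,i}&\text{if neither } (q_{j,i},q_{j',i'}) \text{ nor } (q_{j',i'},q_{j,i}) \text{ is covered by the previous cases.}\end{cases}$$ Quantum geometric $R$-matrix: fix $1\le j\le m-1$, write $p_i=q_{j,i}$, $q_i=q_{j+1,i}$, and $$\kappa_i^\epsilon=\sum_{h=0}^{n-1}p_{i-1}p_{i-2}\cdots p_{i-h}\,q_{i-h-2}q_{i-h-3}\cdots q_{i-n}\qquad(\text{factors in this order}).$$ $R_j^\epsilon$ is given on generators by $$R_j^\epsilon(p_i)=(\kappa_i^\epsilon)^{-1}q_i\,\kappa_{i+1}^\epsilon,\qquad R_j^\epsilon(q_i)=(\kappa_{i+1}^\epsilon)^{-1}p_i\,\kappa_i^\epsilon,$$ and fixes $\epsilon$ and all $q_{j',i}$ with $j'\ne j,j+1$. *)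

(* Defs.v *)
From HB Require Import structures.
From mathcomp Require Import all_boot all_algebra.
From mathcomp Require Import boolp.
From mathcomp Require Import monalg.
Set Implicit Arguments.
Unset Strict Implicit.
Unset Printing Implicit Defensive.
Import GRing.Theory.
Local Open Scope ring_scope.
Local Open Scope quotient_scope.

(* ring_quotient only equips quotients of commutative rings with a product;
   here F is arbitrary, and the ideal is the two-sided one spanned by S. *)
Section PresentedRing.
Variables (F : nzRingType) (S : F -> Prop).

Inductive ideal_span : F -> Prop :=
| ideal_span0 : ideal_span 0
| ideal_spanB x y of ideal_span x & ideal_span y : ideal_span (x - y)
| ideal_spanM a s b of S s : ideal_span (a * s * b).

Definition ideal_pred : {pred F} := fun x => `[< ideal_span x >].

Fact ideal_pred_zmod_closed : zmod_closed ideal_pred.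
Proof.
split=> [|x y /asboolP xI /asboolP yI]; apply/asboolP.
  exact: ideal_span0.
exact: ideal_spanB.
Qed.

HB.instance Definition _ := GRing.isZmodClosed.Build F ideal_pred
  ideal_pred_zmod_closed.

Fact ideal_predMl a x : x \in ideal_pred -> a * x \in ideal_pred.
Proof.
move=> /asboolP xI; apply/asboolP; elim: xI => [|y z _ IHy _ IHz|b s c Ss].
- by rewrite mulr0; exact: ideal_span0.
- by rewrite mulrBr; exact: ideal_spanB.
- by rewrite !mulrA; exact: ideal_spanM.
Qed.

Fact ideal_predMr a x : x \in ideal_pred -> x * a \in ideal_pred.
Proof.
move=> /asboolP xI; apply/asboolP; elim: xI => [|y z _ IHy _ IHz|b s c Ss].
- by rewrite mul0r; exact: ideal_span0.
- by rewrite mulrBl; exact: ideal_spanB.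
- by rewrite -mulrA; exact: ideal_spanM.
Qed.

Definition presented : Type := Quotient.quot ideal_pred.

HB.instance Definition _ := GRing.Zmodule.on presented.

Definition presented_pi (x : F) : presented := \pi_(Quotient.quot ideal_pred) x.

Fact presented_piP (x y : F) :
  presented_pi x = presented_pi y <-> x - y \in ideal_pred.
Proof. by rewrite Quotient.idealrBE; split=> /eqP. Qed.

Fact presented_pi_surj (u : presented) : exists x, u = presented_pi x.
Proof. by exists (repr u); rewrite /presented_pi reprK. Qed.

Fact presented_pi_zmod_morphism : zmod_morphism presented_pi.
Proof. by move=> x y; rewrite /presented_pi !piE. Qed.

Definition presented_one : presented := presented_pi 1.
(* Locked, so that unification does not see the representatives. *)
Definition presented_mul (u v : presented) : presented :=
  locked (presented_pi (repr u * repr v)).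

Fact presented_piM x y :
  presented_mul (presented_pi x) (presented_pi y) = presented_pi (x * y).
Proof.
have repr_pi z : repr (presented_pi z) - z \in ideal_pred.
  by apply/presented_piP; rewrite /presented_pi reprK.
rewrite /presented_mul -lock; apply/presented_piP.
rewrite -(subrK (repr (presented_pi x) * y) (_ * _)) -mulrBr -addrA -mulrBl.
by rewrite rpredD //; [apply: ideal_predMl | apply: ideal_predMr].
Qed.

Fact presented_mulA : associative presented_mul.
Proof.
move=> u v w.
have [x ->] := presented_pi_surj u; have [y ->] := presented_pi_surj v.
by have [z ->] := presented_pi_surj w; rewrite !presented_piM mulrA.
Qed.

Fact presented_mul1 : left_id presented_one presented_mul.
Proof.
by move=> u; have [x ->] := presented_pi_surj u; rewrite presented_piM mul1r.
Qed.

Fact presented_mulr1 : right_id presented_one presented_mul.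
Proof.
by move=> u; have [x ->] := presented_pi_surj u; rewrite presented_piM mulr1.
Qed.

Fact presented_piD x y :
  presented_pi (x + y) = presented_pi x + presented_pi y.
Proof. by rewrite /presented_pi !piE. Qed.

Fact presented_mulDl : left_distributive presented_mul +%R.
Proof.
move=> u v w.
have [x ->] := presented_pi_surj u; have [y ->] := presented_pi_surj v.
have [z ->] := presented_pi_surj w.
by rewrite -presented_piD !presented_piM mulrDl presented_piD.
Qed.

Fact presented_mulDr : right_distributive presented_mul +%R.
Proof.
move=> u v w.
have [x ->] := presented_pi_surj u; have [y ->] := presented_pi_surj v.
have [z ->] := presented_pi_surj w.
by rewrite -presented_piD !presented_piM mulrDr presented_piD.
Qed.

HB.instance Definition _ := GRing.Zmodule_isPzRing.Build presented
  presented_mulA presented_mul1 presented_mulr1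
  presented_mulDl presented_mulDr.

Fact presented_pi_monoid_morphism : monoid_morphism presented_pi.
Proof. by split=> // x y; rewrite -presented_piM. Qed.

HB.instance Definition _ := GRing.isZmodMorphism.Build F presented presented_pi
  presented_pi_zmod_morphism.
HB.instance Definition _ := GRing.isMonoidMorphism.Build F presented
  presented_pi presented_pi_monoid_morphism.

End PresentedRing.

Section Relations.
Variables n m : nat.

(* The pair (j, i) is the index of q_{j+1,i}: rows are numbered from 0 here,
   hence the successor in the definition of the snake paths. *)
Definition qindex : Type := ('I_m * 'Z_n)%type.
HB.instance Definition _ := Finite.on qindex.

Definition snake (k : 'Z_n) : {set qindex} :=
  [set x : qindex | x.2 + (x.1.+1)%:R == 1 + k].

(* qcomm_case x y e : one of the first four cases of the defining relations
   applies to the ordered pair (x, y), giving q_x q_y = eps^e q_y q_x. *)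
Inductive qcomm_case (x y : qindex) : int -> Prop :=
| QCommStepLe k of x \in snake (k + 1) & y \in snake k & (x.1 <= y.1)%N :
    qcomm_case x y 1
| QCommStepGt k of x \in snake (k + 1) & y \in snake k & (y.1 < x.1)%N :
    qcomm_case x y (-1)
| QCommSameLt k of x \in snake k & y \in snake k & (x.1 < y.1)%N :
    qcomm_case x y (-2)
| QCommSameGt k of x \in snake k & y \in snake k & (y.1 < x.1)%N :
    qcomm_case x y 2.

Inductive qcomm (x y : qindex) : int -> Prop :=
| QCommCase e of qcomm_case x y e : qcomm x y e
| QCommNone of (forall e, ~ qcomm_case x y e) & (forall e, ~ qcomm_case y x e) :
    qcomm x y 0.

(* Letters of the free ring: None stands for eps and Some x for q_x; the flag
   true marks the formal inverse. *)
Definition letter : Type := (option qindex * bool)%type.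
HB.instance Definition _ := Countable.on letter.

Definition free_ring : nzRingType := {malg int[{fmonom letter}]}.

Definition free_gen (u : option qindex) (inv : bool) : free_ring :=
  << fmu ((u, inv) : letter) >>.

Definition free_eps_exp (e : int) : free_ring :=
  match e with
  | Posz k => free_gen None false ^+ k
  | Negz k => free_gen None true ^+ k.+1
  end.

Inductive relator : free_ring -> Prop :=
| RelMulV u : relator (free_gen u false * free_gen u true - 1)
| RelVMul u : relator (free_gen u true * free_gen u false - 1)
| RelCentral u b : relator (free_gen None false * free_gen u b
                            - free_gen u b * free_gen None false)
| RelComm x y e of qcomm x y e :
    relator (free_gen (Some x) false * free_gen (Some y) false
             - free_eps_exp e
               * (free_gen (Some y) false * free_gen (Some x) false)).

Definition quantum_torus : pzRingType := presented relator.

Definition torus_eps : quantum_torus := presented_pi relator (free_gen None false).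

Definition torus_q (j : 'I_m) (i : 'Z_n) : quantum_torus :=
  presented_pi relator (free_gen (Some (j, i)) false).

End Relations.

Arguments torus_eps {n m}.
Arguments torus_q {n m} j i.

(* One-sided (right) fractions suffice: they already characterize D as the Ore
   localization of T at its nonzero elements. *)
Record skew_field_of_fractions (T : pzRingType) (D : unitRingType)
    (iota : {rmorphism T -> D}) : Prop := SkewFieldOfFractions {
  skew_field_unit : forall x : D, x != 0 -> x \is a GRing.unit;
  skew_field_inj : injective iota;
  skew_field_frac : forall x : D,
    exists a b : T, b != 0 /\ x = iota a / iota b
}.

Section RMatrix.
Variables (n m : nat) (D : unitRingType).

Definition commutation_relations (eps : D) (q : 'I_m -> 'Z_n -> D) : Prop :=
  forall (x y : qindex n m) (e : int), qcomm x y e ->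
    q x.1 x.2 * q y.1 y.2 = eps ^ e * (q y.1 y.2 * q x.1 x.2).

Definition kappa (p q : 'Z_n -> D) (i : 'Z_n) : D :=
  \sum_(h < n) (\prod_(1 <= a < h.+1) p (i - a%:R))
               * (\prod_(h.+2 <= b < n.+1) q (i - b%:R)).

Definition R_image (q : 'I_m -> 'Z_n -> D) (j j1 l : 'I_m) (i : 'Z_n) : D :=
  let kap := kappa (q j) (q j1) in
  if l == j then (kap i)^-1 * q j1 i * kap (i + 1)
  else if l == j1 then (kap (i + 1))^-1 * q j i * kap i
  else q l i.

End RMatrix.

(* Main.v *)
From HB Require Import structures.
Require Import Defs.
From mathcomp Require Import all_boot all_order all_algebra.
From mathcomp Require Import boolp functions monalg.
From mathcomp Require Import ring zify.
Set Implicit Arguments.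
Unset Strict Implicit.
Unset Printing Implicit Defensive.
Import GRing.Theory Order.TTheory Num.Theory.
Local Open Scope ring_scope.

(** The assignment on generators defines a morphism of the torus into D because
    it preserves the defining relations, and this morphism extends to D because
    it is injective.  The two facts are proved by unrelated means.

    Commutation.  Write p, q for the two rows that are mixed, and let P, Q be
    the products of all the p_i, respectively of all the q_i, in cyclic order.
    These products commute with both rows and do not depend on where the cycle
    is cut, so c = P - Q is the same for all i.  Telescoping the sum kappa gives
    p_i kappa_i - kappa_(i+1) q_i = c, and sorting one factor to the other side
    gives q_i kappa_(i+1) - kappa_i p_i = - c.  With u_i = kappa_i^-1 c the images
    of the generators are therefore p'_i = p_i - u_i and q'_i = q_i + u_(i+1).
    Hence the elements A_i = p_i + q_(i-1) and Z_i = p_i q_i do not change when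
    the rows are replaced by their images, and p' solves the same continued
    fraction p'_(i+1) = A_(i+1) - p'_i^-1 Z_i as p.  The element kappa_i commutes
    up to a power of eps with every Z_j ([Z_kappa]) and with every A_j for j
    other than i ([A_kappa]): p_j and q_(j-1) each fail to do so on a single term
    of kappa_i, and the two defects cancel.  So p'_i commutes with the Z_j, and
    with the A_j for j other than i and i + 1, exactly as p_i does; starting from
    p'_i and p'_(i+1) the continued fraction propagates the commutation of p'_i
    with p'_j around the cycle, and q'_j = p'_j^-1 Z_j does the rest.  The other
    rows see no difference between the terms of kappa_i.

    Injectivity.  By the commutation relations, the images of the generators
    define a morphism phi from the torus to D; it extends to the skew field
    D as soon as it kills no nonzero element ([extend_morphism]).  Every integer
    weight w of the generators gives a valuation of D, of which the value at q_x
    is w(x) ([weight_valuation]).  If the p_i are heavier than the q_i, a single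
    term dominates kappa_i, and the valuation of q'_x is a linear function
    w'(x) of w; the linear map from w to w' is invertible.  An element of the
    torus is a combination of monomials of distinct exponents, and for a generic
    weight ([separating_weight]) the images of these monomials have distinct
    valuations, so that they cannot cancel ([valuation_sum_neq0]).

    Uniqueness holds because the torus is generated by eps and the q_x, and D by
    quotients of elements of the torus. *)

(** * Commutation up to powers of a central unit *)
Section QCommutation.
Variables (D : unitRingType) (eps : D).
Hypothesis eps_unit : eps \is a GRing.unit.
Hypothesis eps_central : forall x, GRing.comm eps x.
Implicit Types (x y z : D) (e f : int).

Definition qcommute x y e : Prop := x * y = eps ^ e * (y * x).

Lemma epsX_central e x : x * eps ^ e = eps ^ e * x.
Proof. exact/commrXz/commr_sym. Qed.

Lemma epsXD e f : eps ^ (e + f) = eps ^ e * eps ^ f.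
Proof. exact: exprzDr. Qed.

Lemma qcommute_eq x y e f : qcommute x y e -> e = f -> qcommute x y f.
Proof. by move=> qxy <-. Qed.

Lemma qcommute1r x : qcommute x 1 0.
Proof. by rewrite /qcommute expr0z !mul1r mulr1. Qed.

Lemma qcommutexx x : qcommute x x 0.
Proof. by rewrite /qcommute expr0z !mul1r. Qed.

Lemma qcommute_sym x y e : qcommute x y e -> qcommute y x (- e).
Proof.
move=> qxy; rewrite /qcommute qxy mulrA -epsXD addrC subrr expr0z.
by rewrite mul1r.
Qed.

Lemma qcommuteMr x y z e f :
  qcommute x y e -> qcommute x z f -> qcommute x (y * z) (e + f).
Proof.
move=> qxy qxz; rewrite /qcommute mulrA qxy -!mulrA qxz.
by rewrite (mulrA y) epsX_central !mulrA epsXD.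
Qed.

Lemma qcommuteMl x y z e f :
  qcommute x z e -> qcommute y z f -> qcommute (x * y) z (e + f).
Proof.
move=> /qcommute_sym qxz /qcommute_sym qyz.
by apply: qcommute_eq (qcommute_sym (qcommuteMr qxz qyz)) _; rewrite opprD !opprK.
Qed.

Lemma qcommuteVr x y e :
  y \is a GRing.unit -> qcommute x y e -> qcommute x y^-1 (- e).
Proof.
move=> uy qxy; apply: (mulIr uy); rewrite -!mulrA (mulrA _ x) mulVr // mulr1.
apply: (mulrI uy); rewrite !mulrA.
rewrite epsX_central -(mulrA _ y) mulrV // mulr1.
have := qcommute_sym qxy; rewrite /qcommute => ->.
by rewrite -mulrA mulrA.
Qed.

Lemma qcommuteVl x y e :
  x \is a GRing.unit -> qcommute x y e -> qcommute x^-1 y (- e).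
Proof.
move=> ux /qcommute_sym qyx; have /qcommute_sym := qcommuteVr ux qyx.
by rewrite opprK.
Qed.

Lemma qcommuteXr x y e k :
  y \is a GRing.unit -> qcommute x y e -> qcommute x (y ^ k) (e * k).
Proof.
move=> uy qxy; have qXn i : qcommute x (y ^+ i) (e * i%:Z).
  elim: i => [|i IHi]; first by rewrite mulr0; exact: qcommute1r.
  by rewrite exprS intS mulrDr mulr1; exact: qcommuteMr.
case: k => k; first exact: qXn.
by rewrite NegzE mulrN; apply: qcommuteVr; rewrite ?unitrX.
Qed.

Lemma qcommute0r x e : qcommute x 0 e.
Proof. by rewrite /qcommute !(mul0r, mulr0). Qed.

Lemma qcommuteDr x y z e :
  qcommute x y e -> qcommute x z e -> qcommute x (y + z) e.
Proof. by rewrite /qcommute => qxy qxz; rewrite mulrDl !mulrDr qxy qxz. Qed.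

Lemma qcommuteNr x y e : qcommute x y e -> qcommute x (- y) e.
Proof. by rewrite /qcommute => qxy; rewrite mulrN mulNr mulrN qxy. Qed.

Lemma qcommuteBr x y z e :
  qcommute x y e -> qcommute x z e -> qcommute x (y - z) e.
Proof. by move=> qxy /qcommuteNr; exact: qcommuteDr. Qed.

Lemma qcommuteDl x y z e :
  qcommute x z e -> qcommute y z e -> qcommute (x + y) z e.
Proof. by rewrite /qcommute => qxz qyz; rewrite mulrDl !mulrDr qxz qyz. Qed.

Lemma qcommuteBl x y z e :
  qcommute x z e -> qcommute y z e -> qcommute (x - y) z e.
Proof. by rewrite /qcommute => qxz qyz; rewrite mulrBl !mulrBr qxz qyz. Qed.

Lemma qcommute_sumr x e (I : Type) (r : seq I) (P : pred I) (F : I -> D) :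
  (forall i, P i -> qcommute x (F i) e) ->
  qcommute x (\sum_(i <- r | P i) F i) e.
Proof.
move=> qF; apply: (big_ind (fun y => qcommute x y e)) => //.
  exact: qcommute0r.
by move=> y z; exact: qcommuteDr.
Qed.

Lemma qcommute_prod_nat x (f : nat -> D) (E : nat -> int) m k :
  (forall b, (m <= b < k)%N -> qcommute x (f b) (E b)) ->
  qcommute x (\prod_(m <= b < k) f b) (\sum_(m <= b < k) E b).
Proof.
move=> qf; rewrite big_seq [X in qcommute _ _ X]big_seq.
apply: (big_ind2 (fun y e => qcommute x y e)) => //.
- exact: qcommute1r.
- by move=> y e z g; exact: qcommuteMr.
- by move=> b; rewrite mem_index_iota; exact: qf.
Qed.

(** All the exponents below are of the form [F b - F b.+1], so that the exponent
    of a product of consecutive generators only depends on its two ends. *)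
Lemma qcommute_prod_telescope x (f : nat -> D) (F : nat -> int) m k :
  (m <= k)%N ->
  (forall b, (m <= b < k)%N -> qcommute x (f b) (F b - F b.+1)) ->
  qcommute x (\prod_(m <= b < k) f b) (F m - F k).
Proof.
move=> le_mk /qcommute_prod_nat q; apply: (qcommute_eq q).
by rewrite -[RHS]opprB -telescope_sumr // -sumrN; apply: eq_bigr => b _; ring.
Qed.

End QCommutation.

(** * The sums kappa and the two rows *)
Section Kappa.
Variables (D : unitRingType) (eps : D).
Hypothesis eps_unit : eps \is a GRing.unit.
Hypothesis eps_central : forall x, GRing.comm eps x.
Variable n : nat.
Hypothesis n_ge3 : (2 < n)%N.
Local Notation qcommute := (qcommute eps).

Definition kron (s : 'Z_n) : int := (s == 0)%:R.

(** Exponents of eps for two generators of the same row, respectively for one of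
    row [j] and one of row [j + 1], as functions of the difference of the second
    indices.  Being differences of values of [kron], they telescope along
    products of consecutive generators. *)
Definition row_exponent (s : 'Z_n) : int := kron (s - 1) - kron (s + 1).
Definition step_exponent (s : 'Z_n) : int :=
  kron (s - 2) - kron (s - 1) *+ 2 + kron s.

Lemma kronN s : kron (- s) = kron s.
Proof. by rewrite /kron oppr_eq0. Qed.

Lemma Zn_nat_eq0 k : (k%:R == 0 :> 'Z_n) = (n %| k)%N.
Proof.
have n_gt1 : (1 < n)%N by apply: ltnW.
rewrite -(inj_eq val_inj) /= val_Zp_nat //.
Qed.

Lemma Zn_nat_self : n%:R = 0 :> 'Z_n.
Proof. by apply/eqP; rewrite Zn_nat_eq0. Qed.

Lemma kron_0 : kron 0 = 1. Proof. by rewrite /kron eqxx. Qed.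

Lemma kron_nat k : (0 < k < n)%N -> kron k%:R = 0.
Proof. by case/andP=> k0 kn; rewrite /kron Zn_nat_eq0 gtnNdvd. Qed.

Lemma kron_1 : kron 1 = 0. Proof. exact: (@kron_nat 1 (ltnW n_ge3)). Qed.
Lemma kron_2 : kron 2 = 0. Proof. exact: (@kron_nat 2 n_ge3). Qed.

Variables p q : 'Z_n -> D.
Hypothesis q_unit : forall i, q i \is a GRing.unit.
Hypothesis qpp : forall i k, qcommute (p i) (p k) (row_exponent (i - k)).
Hypothesis qqq : forall i k, qcommute (q i) (q k) (row_exponent (i - k)).
Hypothesis qpq : forall i k, qcommute (p i) (q k) (step_exponent (i - k)).

Lemma qqp i k : qcommute (q i) (p k) (- step_exponent (k - i)).
Proof. exact: qcommute_sym. Qed.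

Local Notation kap := (kappa p q).

Definition pprod (i : 'Z_n) (m k : nat) : D := \prod_(m <= a < k) p (i - a%:R).
Definition qprod (i : 'Z_n) (m k : nat) : D := \prod_(m <= a < k) q (i - a%:R).
Definition kterm (i : 'Z_n) (h : nat) : D := pprod i 1 h.+1 * qprod i h.+2 n.+1.

Lemma kappaE i : kap i = \sum_(h < n) kterm i h.
Proof. by []. Qed.

Lemma qcommute_row_prod (r : 'Z_n -> D) j i m k (s := j - i) : (m <= k)%N ->
  (forall i k, qcommute (r i) (r k) (row_exponent (i - k))) ->
  qcommute (r j) (\prod_(m <= a < k) r (i - a%:R))
    (kron (s + m%:R - 1) + kron (s + m%:R) - kron (s + k%:R - 1) - kron (s + k%:R)).
Proof.
move=> le_mk qr; pose F b := kron (s + b%:R - 1) + kron (s + b%:R).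
suff qF : qcommute (r j) (\prod_(m <= a < k) r (i - a%:R)) (F m - F k).
  by apply: (qcommute_eq qF); rewrite /F opprD addrA.
apply: qcommute_prod_telescope => // b _; apply: (qcommute_eq (qr _ _)).
rewrite /F /row_exponent /s -(@natr1 _ b).
have -> : j - (i - b%:R) - 1 = j - i + b%:R - 1 by ring.
have -> : j - (i - b%:R) + 1 = j - i + (b%:R + 1) by ring.
have -> : j - i + (b%:R + 1) - 1 = j - i + b%:R by ring.
by ring.
Qed.

Lemma qcommute_p_qprod j i m k (s := j - i) : (m <= k)%N ->
  qcommute (p j) (qprod i m k)
    (kron (s + m%:R - 2) - kron (s + m%:R - 1)
     - kron (s + k%:R - 2) + kron (s + k%:R - 1)).
Proof.
move=> le_mk; pose F b := kron (s + b%:R - 2) - kron (s + b%:R - 1).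
suff qF : qcommute (p j) (qprod i m k) (F m - F k).
  by apply: (qcommute_eq qF); rewrite /F; ring.
apply: qcommute_prod_telescope => // b _; apply: (qcommute_eq (qpq _ _)).
rewrite /F /step_exponent /s -(@natr1 _ b).
have -> : j - (i - b%:R) - 1 = j - i + b%:R - 1 by ring.
have -> : j - (i - b%:R) - 2 = j - i + b%:R - 2 by ring.
have -> : j - (i - b%:R) = j - i + b%:R by ring.
have -> : j - i + (b%:R + 1) - 1 = j - i + b%:R by ring.
have -> : j - i + (b%:R + 1) - 2 = j - i + b%:R - 1 by ring.
by ring.
Qed.

Lemma qcommute_q_pprod j i m k (s := j - i) : (m <= k)%N ->
  qcommute (q j) (pprod i m k)
    (kron (s + m%:R + 1) - kron (s + m%:R)
     - kron (s + k%:R + 1) + kron (s + k%:R)).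
Proof.
move=> le_mk; pose F b := kron (s + b%:R + 1) - kron (s + b%:R).
suff qF : qcommute (q j) (pprod i m k) (F m - F k).
  by apply: (qcommute_eq qF); rewrite /F; ring.
apply: qcommute_prod_telescope => // b _; apply: (qcommute_eq (qqp _ _)).
rewrite /F /step_exponent /s -(@natr1 _ b).
have -> : i - b%:R - j - 1 = - (j - i + (b%:R + 1)) by ring.
have -> : i - b%:R - j - 2 = - (j - i + (b%:R + 1) + 1) by ring.
have -> : i - b%:R - j = - (j - i + b%:R) by ring.
have -> : j - i + b%:R + 1 = j - i + (b%:R + 1) by ring.
rewrite !kronN.
by ring.
Qed.

(** The exponent is the same for all [h], except for the one at which the gap
    between the two factors of [kterm] is at the index [j]. *)
Lemma qcommute_p_kterm j i h (s := j - i) : (h < n)%N ->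
  qcommute (p j) (kterm i h)
    (kron s *+ 2 + kron (s + 1) - kron (s - 1) - kron (s + h%:R + 1) *+ 2).
Proof.
move=> lt_hn.
apply: (qcommute_eq (qcommuteMr eps_unit eps_central
  (@qcommute_row_prod p j i 1 h.+1 isT qpp) (qcommute_p_qprod j i _))).
  by rewrite !ltnS.
rewrite -/s -(@natr1 _ h.+1) -(@natr1 _ h) -(@natr1 _ n) Zn_nat_self.
have -> : s + 1%:R - 1 = s by ring.
have -> : s + (0 + 1) - 1 = s by ring.
have -> : s + (0 + 1) - 2 = s - 1 by ring.
have -> : s + (h%:R + 1 + 1) - 1 = s + h%:R + 1 by ring.
have -> : s + (h%:R + 1 + 1) - 2 = s + h%:R by ring.
have -> : s + (h%:R + 1) - 1 = s + h%:R by ring.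
have -> : s + (h%:R + 1) = s + h%:R + 1 by ring.
ring.
Qed.

Lemma qcommute_q_kterm j i h (s := j - i) : (h < n)%N ->
  qcommute (q j) (kterm i h)
    (kron (s + 2) - kron (s + 1) *+ 2 - kron s + kron (s + h%:R + 1) *+ 2).
Proof.
move=> lt_hn.
apply: (qcommute_eq (qcommuteMr eps_unit eps_central
  (@qcommute_q_pprod j i 1 h.+1 isT) (@qcommute_row_prod q j i _ _ _ qqq))).
  by rewrite !ltnS.
rewrite -/s -(@natr1 _ h.+1) -(@natr1 _ h) -(@natr1 _ n) Zn_nat_self.
have -> : s + 1%:R + 1 = s + 2 by ring.
have -> : s + (0 + 1) - 1 = s by ring.
have -> : s + (0 + 1) = s + 1 by ring.
have -> : s + (h%:R + 1 + 1) - 1 = s + h%:R + 1 by ring.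
have -> : s + (h%:R + 1) + 1 = s + (h%:R + 1 + 1) by ring.
have -> : s + (h%:R + 1) = s + h%:R + 1 by ring.
ring.
Qed.

Lemma sum_single (G : nat -> D) h0 : (h0 < n)%N ->
  (forall h, (h < n)%N -> h != h0 -> G h = 0) -> \sum_(h < n) G h = G h0.
Proof.
move=> lt_h0 G0; rewrite (bigD1 (Ordinal lt_h0)) //= big1 ?addr0 // => h ne_h.
exact: G0.
Qed.

Lemma pprodS (i : 'Z_n) m k : pprod (i + 1) m.+1 k.+1 = pprod i m k.
Proof.
by rewrite /pprod big_add1; apply: eq_bigr => a _; rewrite -natr1; congr p; ring.
Qed.

Lemma qprodS (i : 'Z_n) m k : qprod (i + 1) m.+1 k.+1 = qprod i m k.
Proof.
by rewrite /qprod big_add1; apply: eq_bigr => a _; rewrite -natr1; congr q; ring.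
Qed.

Definition pcycle : D := pprod 0 0 n.
Definition qcycle : D := qprod 0 0 n.
Definition cycle_diff : D := pcycle - qcycle.

Lemma Zn_shift_const (f : 'Z_n -> D) (i k : 'Z_n) :
  (forall i, f (i + 1) = f i) -> f i = f k.
Proof.
move=> fS; suff f0 j : f j = f 0 by rewrite !f0.
rewrite -(natr_Zp j); elim: (val j) => // m IHm.
by rewrite -natr1 fS.
Qed.

(** A generator commutes with the product of its whole row, so that it can be
    moved from the head to the tail of that product. *)
Lemma row_cycle_shift (r : 'Z_n -> D) (i : 'Z_n) :
  (forall i k, qcommute (r i) (r k) (row_exponent (i - k))) ->
  \prod_(0 <= a < n) r (i + 1 - a%:R) = \prod_(0 <= a < n) r (i - a%:R).
Proof.
move=> qr; have n_gt0 : (0 < n)%N by apply: leq_trans n_ge3.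
have nE : n.-1%:R = -1 :> 'Z_n.
  by apply/eqP; rewrite -subr_eq0 opprK natr1 prednK // Zn_nat_self.
rewrite big_ltn // big_add1 mulr0n subr0.
rewrite (eq_bigr (fun a => r (i - a%:R))); last first.
  by move=> a _; rewrite -natr1; congr r; ring.
rewrite -[X in _ = \prod_(0 <= a < X) _](prednK n_gt0) big_nat_recr //= nE opprK.
have := @qcommute_row_prod r (i + 1) i 0 n.-1 isT qr.
rewrite nE [X in kron (X - 1)](_ : _ = 1); last by ring.
rewrite /qcommute (_ : _ + _ - _ - _ = 0) ?expr0z ?mul1r //.
have -> : i + 1 - i + 0%:R = 1 by ring.
have -> : i + 1 - i - 1 - 1 = -1 by ring.
have -> : i + 1 - i - 1 = 0 by ring.
by rewrite subrr kronN kron_1 kron_0.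
Qed.

Lemma pcycleE (i : 'Z_n) : pprod i 0 n = pcycle.
Proof.
apply: (@Zn_shift_const (fun i => pprod i 0 n)) => k.
exact: row_cycle_shift.
Qed.

Lemma qcycleE (i : 'Z_n) : qprod i 0 n = qcycle.
Proof.
apply: (@Zn_shift_const (fun i => qprod i 0 n)) => k.
exact: row_cycle_shift.
Qed.

Lemma p_cycle_diff j : qcommute (p j) cycle_diff 0.
Proof.
apply: qcommuteBr.
  apply: (qcommute_eq (@qcommute_row_prod p j 0 0 n isT qpp)).
  by rewrite Zn_nat_self; ring.
apply: (qcommute_eq (@qcommute_p_qprod j 0 0 n isT)).
by rewrite Zn_nat_self; ring.
Qed.

Lemma q_cycle_diff j : qcommute (q j) cycle_diff 0.
Proof.
apply: qcommuteBr.
  apply: (qcommute_eq (@qcommute_q_pprod j 0 0 n isT)).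
  by rewrite Zn_nat_self; ring.
apply: (qcommute_eq (@qcommute_row_prod q j 0 0 n isT qqq)).
by rewrite Zn_nat_self; ring.
Qed.

(** Multiplying by [p i] on the left and by [q i] on the right turns the two sums
    kappa into consecutive parts of the same sequence, so that the difference
    telescopes to its extreme terms, the products of the two rows. *)
Lemma kappa_step (i : 'Z_n) : p i * kap i - kap (i + 1) * q i = cycle_diff.
Proof.
pose U h := pprod i 0 h * qprod i h.+1 n.+1.
rewrite !kappaE mulr_sumr mulr_suml -sumrB.
transitivity (\sum_(0 <= h < n) (U h.+1 - U h)).
  rewrite big_mkord; apply: eq_bigr => h _; congr (_ - _).
    by rewrite /U /kterm mulrA [pprod i 0 _]big_ltn // subr0.
  rewrite /kterm -mulrA pprodS qprodS /U; congr (_ * _).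
  by rewrite /qprod big_nat_recr // Zn_nat_self subr0.
rewrite telescope_sumr // /U pcycleE [pprod i 0 0]big_geq // mul1r /qprod big_geq //.
by rewrite mulr1 -/(qprod i 1 n.+1) -(subrK 1 i) qprodS qcycleE.
Qed.

(** Only the last term of [kap i], which together with [p i] makes the whole row,
    differs from the others in its exponent. *)
Lemma p_kappa (i : 'Z_n) :
  p i * kap i = eps ^ 2 * (kap i * p i) + (1 - eps ^ 2) * pcycle.
Proof.
have n_gt0 : (0 < n)%N by apply: leq_trans n_ge3.
apply/eqP; rewrite [eqbRHS]addrC -subr_eq; apply/eqP.
rewrite !kappaE mulr_suml !mulr_sumr -sumrB.
have expo h : (h < n)%N ->
    qcommute (p i) (kterm i h) (2 - kron (h.+1%:R) *+ 2).
  move=> lt_h; apply: (qcommute_eq (@qcommute_p_kterm i i h lt_h)).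
  rewrite subrr add0r sub0r kronN kron_1 kron_0 add0r natr1; ring.
rewrite (@sum_single (fun h => p i * kterm i h - eps ^ 2 * (kterm i h * p i)) n.-1).
- have lt_n : (n.-1 < n)%N by rewrite prednK.
  have := expo _ lt_n; rewrite prednK // Zn_nat_self kron_0 subrr.
  rewrite /qcommute expr0z mul1r => qn; rewrite -qn -{1}[p i * _]mul1r -mulrBl.
  congr (_ * _); rewrite /kterm mulrA /qprod big_geq ?mulr1 ?prednK //.
  by rewrite -(pcycleE i) [RHS]big_ltn // subr0.
- by rewrite prednK.
- move=> h lt_h ne_h; have lt_hS : (0 < h.+1 < n)%N.
    by rewrite /= ltn_neqAle lt_h andbT -(prednK n_gt0) eqSS.
  by rewrite (expo _ lt_h) kron_nat // mul0rn subr0 subrr.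
Qed.

Lemma q_kappa (i : 'Z_n) :
  q i * kap (i + 1) = eps ^ (- 2) * (kap (i + 1) * q i) + (1 - eps ^ (- 2)) * qcycle.
Proof.
have n_gt0 : (0 < n)%N by apply: leq_trans n_ge3.
apply/eqP; rewrite [eqbRHS]addrC -subr_eq; apply/eqP.
rewrite !kappaE mulr_suml !mulr_sumr -sumrB.
have expo h : (h < n)%N ->
    qcommute (q i) (kterm (i + 1) h) (- 2 + kron (h%:R) *+ 2).
  move=> lt_h; apply: (qcommute_eq (@qcommute_q_kterm i (i + 1) h lt_h)).
  have -> : i - (i + 1) + 2 = 1 by ring.
  have -> : i - (i + 1) + 1 = 0 by ring.
  have -> : i - (i + 1) + h%:R + 1 = h%:R by ring.
  have -> : i - (i + 1) = -1 by ring.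
  rewrite kronN kron_1 kron_0; ring.
rewrite (@sum_single (fun h => q i * kterm (i + 1) h
  - eps ^ (- 2) * (kterm (i + 1) h * q i)) 0) //.
- have := expo _ n_gt0; rewrite kron_0 [- 2 + _]addrC subrr.
  rewrite /qcommute expr0z mul1r => qn; rewrite -qn -{1}[q i * _]mul1r -mulrBl.
  congr (_ * _); rewrite /kterm /pprod big_geq // mul1r -(qcycleE i) qprodS.
  by rewrite [RHS]big_ltn // subr0.
- move=> h lt_h ne_h; have lt_h0 : (0 < h < n)%N by rewrite lt0n ne_h.
  by rewrite (expo _ lt_h) kron_nat // mul0rn addr0 subrr.
Qed.

(** [kappa_step] read in the opposite order: the corrections of [p_kappa] and
    [q_kappa] add up to change the sign of [cycle_diff]. *)
Lemma kappa_step_rev (i : 'Z_n) : q i * kap (i + 1) = kap i * p i - cycle_diff.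
Proof.
have kq : kap (i + 1) * q i = p i * kap i - cycle_diff.
  by rewrite -(kappa_step i) opprB addrCA subrr addr0.
rewrite q_kappa kq p_kappa /cycle_diff; set a := kap i * p i.
have -> : eps ^ 2 * a + (1 - eps ^ 2) * pcycle - (pcycle - qcycle)
          = eps ^ 2 * (a - pcycle) + qcycle.
  rewrite mulrBl mul1r mulrBr opprB addrACA [pcycle - _ - _]addrAC subrr sub0r.
  by rewrite addrAC.
rewrite mulrDr mulrA -(epsXD eps_unit) addNr expr0z mul1r mulrBl mul1r.
by rewrite [qcycle - _]addrC addrA addrK opprB [qcycle - _]addrC addrA.
Qed.

(** The exponent of [p i] and [p j * q j], as a function of [j - i]. *)
Definition prod_exponent (s : 'Z_n) : int :=
  row_exponent (- s) + step_exponent (- s).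

Lemma row_exponentN s : row_exponent (- s) = kron (s + 1) - kron (s - 1).
Proof. by rewrite /row_exponent -opprD kronN -[in X in _ - X]kronN opprD opprK. Qed.

Lemma step_exponentN s :
  step_exponent (- s) = kron (s + 2) - kron (s + 1) *+ 2 + kron s.
Proof. by rewrite /step_exponent -!opprD !kronN. Qed.

Lemma row_exponent0 : row_exponent 0 = 0.
Proof. by rewrite /row_exponent sub0r add0r kronN subrr. Qed.

Lemma kron_natB a b : (0 < a < n)%N -> (b <= n)%N -> b != a ->
  kron (b%:R - a%:R) = 0.
Proof.
case/andP=> a_gt0 lt_an le_bn; rewrite neq_ltn => /orP[lt_ba|lt_ab].
  rewrite -kronN opprB -natrB 1?ltnW // kron_nat // subn_gt0 lt_ba /=.
  exact: leq_ltn_trans (leq_subr _ _) lt_an.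
rewrite -natrB 1?ltnW // kron_nat // subn_gt0 lt_ab /=.
apply: leq_trans le_bn; rewrite ltn_subrL a_gt0.
exact: leq_trans lt_ab.
Qed.

Local Notation Z j := (p j * q j).
Local Notation A j := (p j + q (j - 1)).

Lemma Z_kappa (j i : 'Z_n) : qcommute (Z j) (kap i) (prod_exponent (j - i)).
Proof.
rewrite kappaE; apply: qcommute_sumr => h _.
apply: (qcommute_eq (qcommuteMl eps_unit eps_central
  (@qcommute_p_kterm j i h (ltn_ord h)) (@qcommute_q_kterm j i h (ltn_ord h)))).
rewrite /prod_exponent row_exponentN step_exponentN; ring.
Qed.

(** [p j] has an exceptional exponent on the term of index [a - 1] of [kap i] and
    [q (j - 1)] on the term of index [a], where [a] is [i - j].  These two terms
    only differ by the exchange of [q (j - 1)] and [p j], so that the defects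
    compensate. *)
Lemma A_kappa (j i : 'Z_n) : j != i ->
  qcommute (A j) (kap i) (kron (j - i + 1) - kron (j - i - 1)).
Proof.
move=> ne_ji; set s := j - i; set lam := kron _ - kron _.
pose a := val (i - j); have aE : a%:R = i - j by rewrite /a natr_Zp.
have sE : s = - a%:R by rewrite aE opprB.
have n_gt1 : (1 < n)%N by apply: ltnW.
have a_lt : (a < n)%N by rewrite -[X in (_ < X)%N](Zp_cast n_gt1); exact: ltn_ord.
have a_gt0 : (0 < a)%N.
  rewrite lt0n; apply/eqP => a0; move/eqP: aE; rewrite a0 eq_sym subr_eq0.
  by rewrite eq_sym (negPf ne_ji).
have a_bd : (0 < a < n)%N by rewrite a_gt0.
have s0 : kron s = 0 by rewrite sE kronN kron_nat.
have expo_p h : (h < n)%N ->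
    qcommute (p j) (kterm i h) (lam - kron (h.+1%:R - a%:R) *+ 2).
  move=> lt_h; apply: (qcommute_eq (@qcommute_p_kterm j i h lt_h)).
  rewrite -/s s0 (_ : s + h%:R + 1 = h.+1%:R - a%:R) /lam; first by ring.
  by rewrite sE -[h.+1%:R]natr1; ring.
have expo_q h : (h < n)%N ->
    qcommute (q (j - 1)) (kterm i h) (lam + kron (h%:R - a%:R) *+ 2).
  move=> lt_h; apply: (qcommute_eq (@qcommute_q_kterm (j - 1) i h lt_h)).
  rewrite (_ : j - 1 - i + h%:R + 1 = h%:R - a%:R); last first.
    by rewrite -[- a%:R]sE /s; ring.
  have -> : j - 1 - i + 2 = s + 1 by rewrite /s; ring.
  have -> : j - 1 - i + 1 = s by rewrite /s; ring.
  have -> : j - 1 - i = s - 1 by rewrite /s; ring.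
  by rewrite s0 /lam; ring.
have a1_lt : (a.-1 < n)%N by rewrite prednK // ltnW.
have ia : i - a%:R = j by rewrite aE; ring.
have ia1 : i - a.+1%:R = j - 1 by rewrite -natr1 aE; ring.
(* The two exceptional terms are X * q (j - 1) * Y and X * p j * Y. *)
have defect : p j * kterm i a.-1 = eps ^ lam * (kterm i a * q (j - 1)).
  pose X := pprod i 1 a; pose Y := qprod i a.+2 n.+1.
  have -> : kterm i a.-1 = X * (q (j - 1) * Y).
    by rewrite /kterm prednK // [qprod i _ _]big_ltn // ia1.
  have -> : kterm i a = X * p j * Y.
    by rewrite /kterm [pprod i _ a.+1]big_nat_recr //= ia.
  have qX := @qcommute_row_prod p j i 1 a a_gt0 qpp.
  have qY := @qcommute_row_prod q (j - 1) i a.+2 n.+1 a_lt qqq.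
  rewrite !mulrA qX -!mulrA qY (mulrA (p j)) epsX_central //.
  rewrite !mulrA -(mulrA _ X) epsX_central // !mulrA -(epsXD eps_unit).
  congr (eps ^ _ * _ * _ * _ * _).
  rewrite -/s -(@natr1 _ n) Zn_nat_self -(@natr1 _ a.+1) -(@natr1 _ a).
  have -> : s + 1%:R - 1 = s by ring.
  have -> : s + a%:R - 1 = -1 by rewrite sE; ring.
  have -> : s + a%:R = 0 by rewrite sE; ring.
  have -> : j - 1 - i + (a%:R + 1 + 1) - 1 = 0 by rewrite aE; ring.
  have -> : j - 1 - i + (a%:R + 1 + 1) = 1 by rewrite aE; ring.
  have -> : j - 1 - i + (0 + 1) - 1 = s - 1 by rewrite /s; ring.
  have -> : j - 1 - i + (0 + 1) = s by rewrite /s; ring.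
  by rewrite s0 kronN kron_1 kron_0 /lam; ring.
have defect' : q (j - 1) * kterm i a = eps ^ lam * (kterm i a.-1 * p j).
  have := expo_p _ a1_lt; rewrite prednK // subrr kron_0 => /(qcommute_sym eps_unit).
  rewrite /qcommute => ->.
  have := expo_q _ a_lt; rewrite subrr kron_0 /qcommute => ->; rewrite defect.
  by rewrite !mulrA -!(epsXD eps_unit); congr (eps ^ _ * _ * _ * _); ring.
apply/eqP; rewrite -subr_eq0 mulrDl mulrDr [eps ^ _ * _]mulrDr opprD addrACA.
rewrite !kappaE !(mulr_sumr, mulr_suml) -!sumrB.
rewrite (@sum_single
  (fun h => p j * kterm i h - eps ^ lam * (kterm i h * p j)) a.-1) //.
  rewrite (@sum_single (fun h => q (j - 1) * kterm i h
    - eps ^ lam * (kterm i h * q (j - 1))) a) //.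
    by rewrite defect defect' addrC addrA subrK subrr.
  move=> h lt_h ne_h; rewrite (expo_q _ lt_h).
  by rewrite (kron_natB a_bd (ltnW lt_h) ne_h) mul0rn addr0 subrr.
move=> h lt_h ne_h; rewrite (expo_p _ lt_h) kron_natB // ?mul0rn ?subr0 ?subrr //.
by rewrite -(prednK a_gt0) eqSS.
Qed.

Hypothesis kap_unit : forall i, kap i \is a GRing.unit.

Definition p_image (i : 'Z_n) : D := (kap i)^-1 * q i * kap (i + 1).
Definition q_image (i : 'Z_n) : D := (kap (i + 1))^-1 * p i * kap i.
Local Notation u i := ((kap i)^-1 * cycle_diff).

Lemma p_image_unit i : p_image i \is a GRing.unit.
Proof. by rewrite /p_image !unitrMl ?unitrV ?kap_unit ?q_unit. Qed.

(** The image of a generator differs from it by a multiple of the inverse of a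
    kappa.  Since [p i] and [q (i - 1)] are changed by opposite terms, their sum is
    preserved. *)
Lemma p_imageE i : p_image i = p i - u i.
Proof. by rewrite /p_image -mulrA kappa_step_rev mulrBr mulKr. Qed.

Lemma q_imageE i : q_image i = q i + u (i + 1).
Proof.
have kp : p i * kap i = kap (i + 1) * q i + cycle_diff.
  by rewrite -(kappa_step i) addrC subrK.
by rewrite /q_image -mulrA kp mulrDr mulKr.
Qed.

(** The conjugation by [kap i] and the exchange of [p i] and [q i] contribute
    opposite powers of eps. *)
Lemma p_image_mul_q_image i : p_image i * q_image i = Z i.
Proof.
rewrite /p_image /q_image !mulrA mulrK // -(mulrA _ (q i)) (qqp i i) subrr.
rewrite mulrA epsX_central // -!mulrA (mulrA (p i)).
have := Z_kappa i i; rewrite subrr /qcommute => ->.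
rewrite (mulrA _^-1) epsX_central // -!mulrA mulKr // mulrA -(epsXD eps_unit).
rewrite (_ : _ + _ = 0) ?expr0z ?mul1r //.
by rewrite /prod_exponent oppr0 row_exponent0 add0r; ring.
Qed.

Lemma q_image_quotient i : q_image i = (p_image i)^-1 * Z i.
Proof. by rewrite -p_image_mul_q_image mulKr // p_image_unit. Qed.

(** With [q_image_quotient], the continued fraction that determines the row of
    images from one of its elements. *)
Lemma p_image_succ i : p_image (i + 1) = A (i + 1) - q_image i.
Proof. by rewrite p_imageE q_imageE addrK opprD addrA addrK. Qed.

Lemma qcommute_u x i e :
  qcommute x (kap i) e -> qcommute x cycle_diff 0 -> qcommute (u i) x e.
Proof.
move=> qk qc; have := qcommuteMr eps_unit eps_central
  (qcommuteVr eps_unit eps_central (kap_unit i) qk) qc.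
by move=> /(qcommute_sym eps_unit); rewrite addr0 opprK.
Qed.

Lemma Z_cycle_diff j : qcommute (Z j) cycle_diff 0.
Proof. exact: (qcommuteMl eps_unit eps_central (p_cycle_diff j) (q_cycle_diff j)). Qed.

Lemma A_cycle_diff j : qcommute (A j) cycle_diff 0.
Proof.
by apply: qcommuteDl => //; [exact: p_cycle_diff | exact: q_cycle_diff].
Qed.

Lemma p_image_Z i j : qcommute (p_image i) (Z j) (prod_exponent (j - i)).
Proof.
rewrite p_imageE; apply: qcommuteBl => //.
  apply: (qcommute_eq (qcommuteMr eps_unit eps_central (qpp i j) (qpq i j))).
  by rewrite /prod_exponent (opprB j i).
by apply: qcommute_u (Z_cycle_diff j); exact: Z_kappa.
Qed.

Lemma p_image_A i j : j != i -> j != i + 1 ->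
  qcommute (p_image i) (A j) (kron (j - i + 1)).
Proof.
move=> ne_i ne_i1.
have d0 : kron (j - i) = 0 by rewrite /kron subr_eq0 (negPf ne_i).
have d1 : kron (j - i - 1) = 0.
  by rewrite /kron -addrA -opprD subr_eq0 (negPf ne_i1).
rewrite p_imageE; apply: qcommuteBl => //.
  apply: qcommuteDr.
    by apply: (qcommute_eq (qpp i j)); rewrite -opprB row_exponentN d1 subr0.
  apply: (qcommute_eq (qpq i (j - 1))).
  have -> : i - (j - 1) = - (j - i - 1) by ring.
  have e2 : j - i - 1 + 2 = j - i + 1 by ring.
  by rewrite step_exponentN e2 subrK d0 d1 mul0rn subr0 addr0.
apply: qcommute_u (A_cycle_diff j); apply: (qcommute_eq (A_kappa ne_i)).
by rewrite d1 subr0.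
Qed.

Lemma step_exponent0 : step_exponent 0 = 1.
Proof. by rewrite -oppr0 step_exponentN !add0r kron_2 kron_1 kron_0. Qed.

Lemma row_exponentN1 : row_exponent (- 1) = -1.
Proof. by rewrite row_exponentN kron_2 subrr kron_0. Qed.

(** The pair [p i], [A (i + 1)] satisfies this relation, and so does its image,
    because [p i - p_image i] commutes with [A (i + 1)] up to [eps ^ (- 1)]. *)
Lemma p_image_A_succ i :
  p_image i * A (i + 1) = eps ^ (- 1) * (A (i + 1) * p_image i)
                     + (1 - eps ^ (- 2)) * Z i.
Proof.
have qu : qcommute (u i) (A (i + 1)) (- 1).
  apply: qcommute_u (A_cycle_diff _).
  have ne : i + 1 != i by rewrite -subr_eq0 addrAC subrr add0r.
  apply: (qcommute_eq (A_kappa ne)).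
  have -> : i + 1 - i = 1 by ring.
  by rewrite subrr kron_0 kron_2.
have qp : p i * A (i + 1) = eps ^ (- 1) * (A (i + 1) * p i)
                     + (1 - eps ^ (- 2)) * Z i.
  rewrite !mulrDr !mulrDl mul1r !mulrDr addrK.
  have e1 : i - (i + 1) = -1 by ring.
  rewrite (qpp i (i + 1)) e1 row_exponentN1 -addrA; congr (_ + _).
  have := qqp i i; rewrite subrr step_exponent0 /qcommute => ->.
  by rewrite mulrA -(epsXD eps_unit) mulNr addrC subrK.
rewrite p_imageE mulrBl qp qu addrAC; congr (_ + _); set v := _^-1 * cycle_diff.
by rewrite [in RHS]mulrBr mulrBr.
Qed.

Lemma p_image_q_image_of i j e :
  qcommute (p_image i) (p_image j) e ->
  qcommute (p_image i) (q_image j) (- e + prod_exponent (j - i)).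
Proof.
move=> qpij; rewrite q_image_quotient.
apply: (qcommuteMr eps_unit eps_central) (p_image_Z i j).
exact: (qcommuteVr eps_unit eps_central (p_image_unit j) qpij).
Qed.

Lemma prod_exponent0 : prod_exponent 0 = 1.
Proof. by rewrite /prod_exponent oppr0 row_exponent0 add0r step_exponent0. Qed.

Lemma p_image_p_image_succ i : qcommute (p_image i) (p_image (i + 1)) (- 1).
Proof.
rewrite /qcommute p_image_succ mulrBr mulrBl p_image_A_succ p_image_mul_q_image.
have := qcommute_sym eps_unit (p_image_q_image_of (qcommutexx eps (p_image i))).
rewrite subrr prod_exponent0 addrC subr0 /qcommute p_image_mul_q_image => ->.
rewrite mulrBr !mulrA -(epsXD eps_unit) -addrA; congr (_ + _).
by rewrite !mulrBl mul1r addrAC subrr sub0r -opprD.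
Qed.

(** Induction along the continued fraction: the two terms of the next element
    have the same exponent as long as the index has not come back to [i]. *)
Lemma p_image_p_image_nat i k : (0 < k < n)%N ->
  qcommute (p_image i) (p_image (i + k%:R)) (row_exponent (- k%:R)).
Proof.
elim: k => // -[_ _|k IHk /andP[_ lt_kn]].
  by rewrite row_exponentN1; exact: p_image_p_image_succ.
have lt_k : (0 < k.+1 < n)%N by rewrite /= ltnW.
have lt_k2 : (0 < k.+2 < n)%N by [].
have {IHk} qk := IHk lt_k; set x : 'Z_n := k.+1%:R in qk *.
have x0 : kron x = 0 by exact: kron_nat.
have x1 : kron (x + 1) = 0 by rewrite natr1; exact: kron_nat.
have ne0 (y : 'Z_n) : kron y = 0 -> y != 0 by rewrite /kron; case: eqP.
rewrite -natr1 -/x addrA p_image_succ row_exponentN [x + 1 - 1]addrK x0 subr0.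
have e1 : i + x + 1 - i = x + 1 by ring.
have e2 : i + x - i = x by ring.
apply: qcommuteBr.
  have qA : qcommute (p_image i) (A (i + x + 1)) (kron (x + 1 + 1)).
    rewrite -e1; apply: p_image_A; rewrite -subr_eq0 ?e1; first exact: ne0.
    have -> : i + x + 1 - (i + 1) = x by ring.
    exact: ne0.
  exact: qA.
apply: (qcommute_eq (p_image_q_image_of qk)).
rewrite e2 /prod_exponent addKr step_exponentN x0 x1 mul0rn subr0 addr0.
by congr kron; ring.
Qed.

Lemma p_image_p_image i j : qcommute (p_image i) (p_image j) (row_exponent (i - j)).
Proof.
have n_gt1 : (1 < n)%N by apply: ltnW.
have [<-|ne_ij] := eqVneq i j.
  by rewrite subrr row_exponent0; exact: qcommutexx.
have kE := natr_Zp (j - i); set k := nat_of_ord _ in kE.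
have -> : i - j = - k%:R by rewrite kE opprB.
have -> : j = i + k%:R by rewrite kE; ring.
have k_lt : (k < n)%N by rewrite -[X in (_ < X)%N](Zp_cast n_gt1) ltn_ord.
apply: p_image_p_image_nat; rewrite k_lt andbT lt0n.
by apply: contraNneq ne_ij => k0; move/eqP: kE; rewrite k0 eq_sym subr_eq0 eq_sym.
Qed.

Lemma p_image_q_image i j : qcommute (p_image i) (q_image j) (step_exponent (i - j)).
Proof.
apply: (qcommute_eq (p_image_q_image_of (p_image_p_image i j))).
by rewrite /prod_exponent (opprB j i) addKr.
Qed.

Lemma q_image_q_image i j : qcommute (q_image i) (q_image j) (row_exponent (i - j)).
Proof.
have qVl := qcommuteVl eps_unit eps_central.
have qMl := qcommuteMl eps_unit eps_central.
have qMr := qcommuteMr eps_unit eps_central.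
have Zpp := qcommute_sym eps_unit (p_image_Z j i).
have ZZ := qMr _ _ _ _ _ (qMl _ _ _ _ _ (qpp i j) (qqp i j))
                         (qMl _ _ _ _ _ (qpq i j) (qqq i j)).
have Zqq := qMr _ _ _ _ _ (qcommuteVr eps_unit eps_central (p_image_unit j) Zpp) ZZ.
rewrite -q_image_quotient in Zqq.
have := qMl _ _ _ _ _ (qVl _ _ _ (p_image_unit i) (p_image_q_image i j)) Zqq.
rewrite -q_image_quotient => qij; apply: (qcommute_eq qij).
rewrite opprK /prod_exponent (opprB i j).
have -> : row_exponent (j - i) = - row_exponent (i - j).
  by rewrite -opprB row_exponentN /row_exponent; ring.
ring.
Qed.

Lemma cyclic_sum_shift (E : 'Z_n -> int) (i : 'Z_n) :
  \sum_(1 <= a < n) E (i + 1 - a%:R) + E (i + 1)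
  = E i + \sum_(1 <= a < n) E (i - a%:R).
Proof.
have n_gt0 : (0 < n)%N by apply: leq_trans n_ge3.
have -> : E i + \sum_(1 <= a < n) E (i - a%:R) = \sum_(0 <= a < n) E (i - a%:R).
  by rewrite [RHS]big_ltn // subr0.
rewrite -[X in _ = \sum_(_ <= _ < X) _](prednK n_gt0) big_nat_recr //=.
congr (_ + E _).
  rewrite big_add1; apply: eq_bigr => a _.
  by rewrite -natr1; congr E; ring.
apply: (@addIr _ n.-1%:R); rewrite subrK -addrA [1 + _]addrC natr1 prednK //.
by rewrite Zn_nat_self addr0.
Qed.

(** A generator [r] of a third row sees [p (i + 1)] and [q i], which lie on the
    same snake path, with the same exponent.  Every term of [kap i] consists of one
    factor on each snake path except one, whence a common exponent. *)
Section OtherRow.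
Variables (r : D) (E : 'Z_n -> int).
Hypothesis r_p : forall i, qcommute r (p i) (E i).
Hypothesis r_q : forall i, qcommute r (q i) (E (i + 1)).

Lemma other_kappa (i : 'Z_n) : qcommute r (kap i) (\sum_(1 <= a < n) E (i - a%:R)).
Proof.
rewrite kappaE; apply: qcommute_sumr => -[h lt_h] _ /=.
rewrite (@big_cat_nat _ _ _ h.+1) //=.
apply: (qcommuteMr eps_unit eps_central).
  by apply: (qcommute_prod_nat eps_unit eps_central).
have -> : \sum_(h.+1 <= a < n) E (i - a%:R)
          = \sum_(h.+2 <= a < n.+1) E (i - a%:R + 1).
  rewrite [RHS]big_add1; apply: eq_bigr => a _.
  by rewrite -natr1; congr E; ring.
by apply: (qcommute_prod_nat eps_unit eps_central).
Qed.

Lemma other_p_image i : qcommute r (p_image i) (E i).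
Proof.
have qM := qcommuteMr eps_unit eps_central.
apply: (qcommute_eq (qM _ _ _ _ _ (qM _ _ _ _ _ (qcommuteVr eps_unit eps_central
  (kap_unit i) (other_kappa i)) (r_q i)) (other_kappa (i + 1)))).
by rewrite -addrA [E _ + _]addrC cyclic_sum_shift addrC addrK.
Qed.

Lemma other_q_image i : qcommute r (q_image i) (E (i + 1)).
Proof.
have qM := qcommuteMr eps_unit eps_central.
apply: (qcommute_eq (qM _ _ _ _ _ (qM _ _ _ _ _ (qcommuteVr eps_unit eps_central
  (kap_unit (i + 1)) (other_kappa (i + 1))) (r_p i)) (other_kappa i))).
by rewrite -addrA -cyclic_sum_shift addKr.
Qed.
End OtherRow.
End Kappa.

(** * The quantum torus as a presented ring *)
Section PresentedLift.
Variables (F : nzRingType) (S : F -> Prop) (B : pzRingType).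
Variable psi : {rmorphism F -> B}.
Hypothesis psiS : forall s, S s -> psi s = 0.

Lemma presented_lift :
  exists f : {rmorphism presented S -> B}, forall x, f (presented_pi S x) = psi x.
Proof.
pose f (u : presented S) : B := psi (repr u).
have f_pi x : f (presented_pi S x) = psi x.
  have /presented_piP/asboolP : presented_pi S (repr (presented_pi S x))
                                = presented_pi S x.
    by rewrite /presented_pi generic_quotient.reprK.
  rewrite -[f _](subrK (psi x)) /f -rmorphB => xI.
  rewrite -[RHS]add0r; congr (_ + _).
  elim: xI => [|y z _ IHy _ IHz|a s b Ss]; first exact: rmorph0.
    by rewrite rmorphB IHy IHz subrr.
  by rewrite !rmorphM (psiS Ss) mulr0 mul0r.
have f_add : zmod_morphism f.
  move=> u v; have [x ->] := presented_pi_surj u.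
  have [y ->] := presented_pi_surj v.
  by rewrite -rmorphB !f_pi rmorphB.
have f_mul : monoid_morphism f.
  split=> [|u v]; first by rewrite -[1](rmorph1 (presented_pi S)) f_pi rmorph1.
  have [x ->] := presented_pi_surj u; have [y ->] := presented_pi_surj v.
  by rewrite -rmorphM !f_pi rmorphM.
pose fA := GRing.isZmodMorphism.Build _ _ f f_add.
pose fM := GRing.isMonoidMorphism.Build _ _ f f_mul.
pose fR : {rmorphism presented S -> B} := HB.pack f fA fM.
by exists fR.
Qed.
End PresentedLift.

Section FreeLift.
Variables (n m : nat) (B : nzRingType) (g : letter n m -> B).

Definition word_val (w : fmonom (letter n m)) : B := \prod_(x <- fmonom_val w) g x.

Lemma word_val_mmorphism : mmorphism word_val.
Proof.
split=> [w w'|]; first by rewrite /word_val fmM big_cat.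
by rewrite /word_val fm1 big_nil.
Qed.

HB.instance Definition _ :=
  isMultiplicative.Build (fmonom (letter n m)) B word_val word_val_mmorphism.

Lemma free_lift :
  exists psi : {rmorphism free_ring n m -> B},
    forall u b, psi (free_gen u b) = g (u, b).
Proof.
pose psi : free_ring n m -> B := mmap (fun c : int => c%:~R) word_val.
have psiA : zmod_morphism psi by exact: (@mmap_is_additive _ _ _ (intmul 1)).
have psiM : monoid_morphism psi.
  have [] := @commr_mmap_is_multiplicative _ _ B (intmul 1) word_val.
    by move=> x w w'; exact/commr_sym/commr_int.
  by split.
pose fA := GRing.isZmodMorphism.Build _ _ psi psiA.
pose fM := GRing.isMonoidMorphism.Build _ _ psi psiM.
pose fR : {rmorphism free_ring n m -> B} := HB.pack psi fA fM.
exists fR => u b; rewrite /fR /= /psi /free_gen (@mmapU _ _ _ (intmul 1)) mul1r.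
by rewrite /word_val fmU big_seq1.
Qed.
End FreeLift.

Section RelatorImages.
Variables (R S : pzRingType) (f : {rmorphism R -> S}).
Implicit Types a b c d : R.

Lemma rmorphMB1 a b : f (a * b - 1) = f a * f b - 1.
Proof. by rewrite rmorphB rmorphM rmorph1. Qed.

Lemma rmorphMBM a b c d : f (a * b - c * d) = f a * f b - f c * f d.
Proof. by rewrite rmorphB !rmorphM. Qed.

Lemma rmorphMBMM a b c d d' :
  f (a * b - c * (d * d')) = f a * f b - f c * (f d * f d').
Proof. by rewrite rmorphB !rmorphM. Qed.
End RelatorImages.

Section Torus.
Variables (n m : nat).
Local Notation T := (quantum_torus n m).
Local Notation qindex := (qindex n m).

Definition torus_gen (u : option qindex) (b : bool) : T :=
  presented_pi (@relator n m) (free_gen u b).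

Definition torus_eps_exp (e : int) : T :=
  presented_pi (@relator n m) (free_eps_exp n m e).

Lemma torus_eps_expX e :
  torus_eps_exp e = match e with
                    | Posz k => torus_gen None false ^+ k
                    | Negz k => torus_gen None true ^+ k.+1
                    end.
Proof. by rewrite /torus_eps_exp; case: e => k; rewrite rmorphXn. Qed.

Lemma torus_lift (B : nzRingType) (g : letter n m -> B) :
  (forall u, g (u, false) * g (u, true) = 1) ->
  (forall u, g (u, true) * g (u, false) = 1) ->
  (forall x, GRing.comm (g (None, false)) (g x)) ->
  (forall x y e, qcomm x y e ->
     g (Some x, false) * g (Some y, false)
     = match e with
       | Posz k => g (None, false) ^+ k
       | Negz k => g (None, true) ^+ k.+1
       end * (g (Some y, false) * g (Some x, false))) ->
  exists f : {rmorphism T -> B}, forall u b, f (torus_gen u b) = g (u, b).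
Proof.
move=> gV Vg gC gq; have [psi psiE] := free_lift g.
have [|f fE] := @presented_lift _ (@relator n m) B psi.
  have psi_exp e : psi (free_eps_exp n m e)
              = match e with
                | Posz k => g (None, false) ^+ k
                | Negz k => g (None, true) ^+ k.+1
                end.
    by case: e => k; rewrite /free_eps_exp rmorphXn psiE.
  move=> _ [u|u|u b|x y e qe].
  - by rewrite rmorphMB1 !psiE gV subrr.
  - by rewrite rmorphMB1 !psiE Vg subrr.
  - by rewrite rmorphMBM !psiE gC subrr.
  - by rewrite rmorphMBMM psi_exp !psiE (gq _ _ _ qe) subrr.
by exists f => u b; rewrite fE psiE.
Qed.

Lemma relator_pi0 s : relator s -> presented_pi (@relator n m) s = 0.
Proof.
move=> rs; rewrite -[RHS](rmorph0 (presented_pi (@relator n m))).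
apply/presented_piP/asboolP; rewrite subr0 -[s]mul1r -[1 * s]mulr1.
exact: ideal_spanM.
Qed.

Lemma torus_genV u : torus_gen u false * torus_gen u true = 1.
Proof.
apply/eqP; rewrite -subr_eq0 -rmorphM -[1](rmorph1 (presented_pi (@relator n m))).
by rewrite -rmorphB; apply/eqP/relator_pi0/RelMulV.
Qed.

Lemma torus_Vgen u : torus_gen u true * torus_gen u false = 1.
Proof.
apply/eqP; rewrite -subr_eq0 -rmorphM -[1](rmorph1 (presented_pi (@relator n m))).
by rewrite -rmorphB; apply/eqP/relator_pi0/RelVMul.
Qed.

Lemma torus_gen_central u b :
  GRing.comm (torus_gen None false) (torus_gen u b).
Proof.
apply/eqP; rewrite -subr_eq0 -!rmorphM.
by rewrite -rmorphB; apply/eqP/relator_pi0/RelCentral.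
Qed.

Lemma torus_gen_qcomm x y e : qcomm x y e ->
  torus_gen (Some x) false * torus_gen (Some y) false
  = torus_eps_exp e * (torus_gen (Some y) false * torus_gen (Some x) false).
Proof.
move=> qe; apply/eqP; rewrite -subr_eq0 -!rmorphM.
by rewrite -rmorphB; apply/eqP/relator_pi0/RelComm.
Qed.

Lemma torus_ind (P : T -> Prop) :
  P 1 -> (forall x y, P x -> P y -> P (x - y)) ->
  (forall u b x, P x -> P (torus_gen u b * x)) -> forall x, P x.
Proof.
move=> P1 PB PM x; have [y ->] := presented_pi_surj x.
have P0 : P 0 by rewrite -[0](subrr (1 : T)); exact: PB.
have PD a b : P a -> P b -> P (a + b).
  by move=> Pa Pb; rewrite -[b]opprK -[- b]sub0r; apply: (PB _ _ Pa); exact: PB.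
have Pz a (c : int) : P a -> P (a *~ c).
  move=> Pa; elim: c => [|k IHk|k IHk]; first by rewrite mulr0z.
    by rewrite intS mulrzDr mulr1z; exact: PD.
  by rewrite -add1n PoszD opprD addrC mulrzDr mulrN1z; exact: PB.
have Pw w : P (presented_pi (@relator n m) << w >>).
  case: w => w; elim: w => [|[u b] w IHw].
    have -> : << FMonom [::] >> = 1 :> free_ring n m.
      by congr (<< _ >>); apply/eqP; rewrite fmP fm1.
    by rewrite rmorph1.
  have -> : << FMonom ((u, b) :: w) >>
            = free_gen u b * << FMonom w >> :> free_ring n m.
    rewrite /free_gen malgM_def fgmulUU mulr1; congr (<< _ >>).
    by apply/eqP; rewrite fmP fmM fmU.
  by rewrite rmorphM; exact: PM.
rewrite [y]monalgE raddf_sum; apply: big_ind => // w _.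
have -> : << y@_w *g w >> = << w >> *~ y@_w :> free_ring n m.
  by rewrite -[in LHS](intz y@_w) [LHS]raddfMz.
by rewrite raddfMz; apply: Pz; exact: Pw.
Qed.

End Torus.

(** * Skew fields of fractions and valuations *)

(** Valuation with values in the integers, with the convention of degrees: the
    larger value dominates in a sum, and the value at 0 is arbitrary. *)
Definition valuation (R : pzRingType) (v : R -> int) : Prop :=
  (forall x y, x != 0 -> y != 0 -> v (x * y) = v x + v y) /\
  (forall x y, x != 0 -> y != 0 -> v x < v y -> x + y != 0 /\ v (x + y) = v y).

Section Fractions.
Variables (T : pzRingType) (D : unitRingType) (iota : {rmorphism T -> D}).
Hypothesis hD : skew_field_of_fractions iota.

Lemma D_unit (x : D) : x != 0 -> x \is a GRing.unit.
Proof. exact: skew_field_unit hD x. Qed.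

Lemma D_mulf_neq0 (x y : D) : x != 0 -> y != 0 -> x * y != 0.
Proof.
move=> x0 y0; apply: contraTneq (oner_neq0 D) => xy0.
rewrite negbK; apply/eqP.
rewrite -(mulVr (D_unit x0)) -[x in LHS](mulrK (D_unit y0)) xy0 mul0r mulr0.
by [].
Qed.

Lemma D_invr_neq0 (x : D) : x != 0 -> x^-1 != 0.
Proof. by move=> x0; apply: contraNneq x0 => xV0; rewrite -[x]invrK xV0 invr0. Qed.

Lemma iota_neq0 a : (iota a != 0) = (a != 0).
Proof. by rewrite -(rmorph0 iota) (inj_eq (skew_field_inj hD)). Qed.

Lemma iota_unit a : a != 0 -> iota a \is a GRing.unit.
Proof. by move=> a0; apply: D_unit; rewrite iota_neq0. Qed.

Lemma T_mulf_neq0 (a b : T) : a != 0 -> b != 0 -> a * b != 0.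
Proof. by rewrite -!iota_neq0 rmorphM; exact: D_mulf_neq0. Qed.

(** A left fraction is a right fraction, because right fractions exhaust [D]. *)
Lemma ore_condition b c : b != 0 ->
  exists c' b', [/\ b' != 0, (iota b)^-1 * iota c = iota c' / iota b'
                  & c * b' = b * c'].
Proof.
move=> b0; have [c' [b' [b'0 E]]] := skew_field_frac hD ((iota b)^-1 * iota c).
exists c', b'; split=> //; apply: (skew_field_inj hD); rewrite !rmorphM.
by rewrite -[LHS](mulVKr (iota_unit b0)) (mulrA (iota b)^-1) E mulrVK // iota_unit.
Qed.

(** Two fractions are equal only if they become identical after extending each
    of them; this is what makes functions of fractions well defined. *)
Lemma frac_eq a b c d : b != 0 -> d != 0 ->
  iota a / iota b = iota c / iota d ->
  exists s t, [/\ s != 0, t != 0, a * s = c * t & b * s = d * t].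
Proof.
move=> b0 d0 E; have [t [s [s0 _ bs]]] := ore_condition b d0.
have t0 : t != 0.
  by apply: contraTneq (T_mulf_neq0 b0 s0) => t0; rewrite bs t0 mulr0 eqxx.
exists s, t; split=> //; apply: (skew_field_inj hD); rewrite !rmorphM.
rewrite -[iota a](mulrVK (iota_unit b0)) E -mulrA -rmorphM bs rmorphM mulrA.
by rewrite mulrVK // iota_unit.
Qed.

Lemma common_denominator x y : exists a c e,
  [/\ e != 0, x = iota a / iota e & y = iota c / iota e].
Proof.
have [a [b [b0 ->]]] := skew_field_frac hD x.
have [c [d [d0 ->]]] := skew_field_frac hD y.
have [s [t [t0 _ dt]]] := ore_condition d b0.
have s0 : s != 0.
  by apply: contraTneq (T_mulf_neq0 d0 t0) => s0; rewrite dt s0 mulr0 eqxx.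
have scale u v z : v != 0 -> z != 0 ->
    iota u / iota v = iota (u * z) / iota (v * z).
  move=> v0 z0; rewrite !rmorphM invrM ?iota_unit // mulrA mulrK //.
  exact: iota_unit.
exists (a * s), (c * t), (d * t); split; first exact: T_mulf_neq0.
  by rewrite dt; exact: scale.
exact: scale.
Qed.

Lemma frac_mul x y : exists a b c d s t,
  [/\ [/\ b != 0, d != 0 & t != 0], x = iota a / iota b, y = iota c / iota d,
      c * t = b * s & x * y = iota (a * s) / iota (d * t)].
Proof.
have [a [b [b0 xE]]] := skew_field_frac hD x.
have [c [d [d0 yE]]] := skew_field_frac hD y.
have [s [t [t0 E ct]]] := ore_condition c b0.
exists a, b, c, d, s, t; split=> //.
rewrite xE yE mulrA -(mulrA (iota a)) E !rmorphM invrM ?iota_unit //.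
by rewrite !mulrA.
Qed.

Lemma extend_morphism (phi : {rmorphism T -> D}) :
  (forall a, a != 0 -> phi a != 0) ->
  exists R : {rmorphism D -> D}, forall a, R (iota a) = phi a.
Proof.
move=> phi0; have phiU a : a != 0 -> phi a \is a GRing.unit.
  by move=> a0; exact/D_unit/phi0.
have [|f fP] := @choice D D (fun x y => exists a b,
    [/\ b != 0, x = iota a / iota b & y = phi a / phi b]).
  move=> x.
  have [a [b [b0 xE]]] := skew_field_frac hD x.
  by exists (phi a / phi b), a, b.
have fE a b : b != 0 -> f (iota a / iota b) = phi a / phi b.
  move=> b0; have [a' [b' [b'0 E ->]]] := fP (iota a / iota b).
  have [s [t [s0 t0 aE bE]]] := frac_eq b0 b'0 E.
  have scale u v z : v != 0 -> z != 0 ->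
      phi u / phi v = phi (u * z) / phi (v * z).
    by move=> v0 z0; rewrite !rmorphM invrM ?phiU // mulrA mulrK // phiU.
  by rewrite (scale a b s) // (scale a' b' t) // aE bE.
have f_iota a : f (iota a) = phi a.
  rewrite -[iota a]divr1 -(rmorph1 iota) fE ?rmorph1 ?divr1 //.
  by rewrite -iota_neq0 rmorph1 oner_neq0.
have fA : zmod_morphism f.
  move=> x y; have [a [c [e [e0 -> ->]]]] := common_denominator x y.
  by rewrite -mulrBl -rmorphB !fE // rmorphB mulrBl.
have fM : monoid_morphism f.
  split=> [|x y]; first by have := f_iota 1; rewrite !rmorph1.
  have [a [b [c [d [s [t [[b0 d0 t0] -> -> ct ->]]]]]]] := frac_mul x y.
  rewrite !fE ?T_mulf_neq0 // !rmorphM invrM ?phiU // !mulrA; congr (_ / _).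
  rewrite -!mulrA; congr (_ * _); apply: (canRL (mulKr (phiU _ b0))).
  by rewrite mulrA -rmorphM -ct rmorphM mulrK ?phiU.
pose hA := GRing.isZmodMorphism.Build _ _ f fA.
pose hM := GRing.isMonoidMorphism.Build _ _ f fM.
pose R : {rmorphism D -> D} := HB.pack f hA hM.
by exists R.
Qed.

Lemma extend_valuation (v : T -> int) : valuation v ->
  exists2 V : D -> int, valuation V & forall a, a != 0 -> V (iota a) = v a.
Proof.
move=> [vM vD].
have [|V VP] := @choice D int (fun x k => x != 0 -> exists a b,
    [/\ a != 0, b != 0, x = iota a / iota b & k = v a - v b]).
  move=> x.
  have [a [b [b0 xE]]] := skew_field_frac hD x.
  exists (v a - v b) => x0; exists a, b; split=> //.
  by apply: contraNneq x0 => a0; rewrite xE a0 rmorph0 mul0r.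
have frac0 a b : a != 0 -> b != 0 -> iota a / iota b != 0.
  by move=> a0 b0; rewrite D_mulf_neq0 ?D_invr_neq0 ?iota_neq0.
have num0 a b : iota a / iota b != 0 -> a != 0.
  by apply: contraNneq => ->; rewrite rmorph0 mul0r.
have VE a b : a != 0 -> b != 0 -> V (iota a / iota b) = v a - v b.
  move=> a0 b0; have [a' [b' [a'0 b'0 E ->]]] := VP _ (frac0 _ _ a0 b0).
  have [s [t [s0 t0 aE bE]]] := frac_eq b0 b'0 E.
  have := vM _ _ a0 s0; rewrite aE vM // => aV.
  have := vM _ _ b0 s0; rewrite bE vM // => bV.
  lia.
have one0 : 1 != 0 :> T by rewrite -iota_neq0 rmorph1 oner_neq0.
exists V; last first.
  move=> a a0; rewrite -[iota a]divr1 -(rmorph1 iota) VE //.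
  by have := vM _ _ a0 one0; rewrite mulr1; lia.
split=> x y.
  have [a [b [c [d [s [t [[b0 d0 t0] -> -> ct ->]]]]]]] := frac_mul x y.
  move=> /num0 a0 /num0 c0.
  have s0 : s != 0.
    by apply: contraTneq (T_mulf_neq0 c0 t0) => s0; rewrite ct s0 mulr0 eqxx.
  rewrite !VE ?T_mulf_neq0 // !vM //.
  by have := vM _ _ c0 t0; rewrite ct vM //; lia.
have [a [c [e [e0 -> ->]]]] := common_denominator x y.
move=> /num0 a0 /num0 c0; rewrite !VE // ltrD2r => lt_v.
have [ac0 acE] := vD _ _ a0 c0 lt_v.
by rewrite -mulrDl -rmorphD frac0 // VE // acE.
Qed.

End Fractions.

Section ValuationSums.
Variables (R : nzRingType) (v : R -> int).
Hypothesis hv : valuation v.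

Lemma valuation1 : v 1 = 0.
Proof.
have := hv.1 1 1 (oner_neq0 _) (oner_neq0 _); rewrite mulr1.
by move: (v 1) => e; lia.
Qed.

(** The term of largest valuation cannot be cancelled by the others. *)
Lemma valuation_sum_neq0 (I : eqType) (s : seq I) (F : I -> R) : uniq s ->
  (forall i, i \in s -> F i != 0) ->
  {in s &, injective (fun i => v (F i))} -> (0 < size s)%N ->
  \sum_(i <- s) F i != 0.
Proof.
move=> Us F0 vI s0; suff [] : \sum_(i <- s) F i != 0
    /\ exists2 i, i \in s & v (\sum_(i <- s) F i) = v (F i) by [].
elim: s Us F0 vI s0 => // i [_ _ F0 _ _|k s IHs].
  rewrite big_seq1 F0 ?mem_head //; split=> //.
  by exists i; rewrite ?mem_head.
rewrite cons_uniq => /andP[iNs Us] F0 vI _.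
have [l ls|x y xs ys|//|S0 [l ls Sl]] := IHs Us.
- by apply: F0; rewrite inE ls orbT.
- by apply: vI; rewrite inE ?xs ?ys orbT.
have i_in : i \in i :: k :: s by rewrite mem_head.
have l_in : l \in i :: k :: s by rewrite inE ls orbT.
have ne_v : v (F i) != v (F l).
  by apply: contraNneq iNs => /vI -> //.
rewrite big_cons; set S := \sum_(_ <- _) _ in S0 Sl *.
have Fi0 := F0 _ i_in.
case: (ltgtP (v (F i)) (v (F l))) ne_v => // lt_v _.
  rewrite -Sl in lt_v; have [iS0 iSE] := hv.2 _ _ Fi0 S0 lt_v.
  by split=> //; exists l => //; rewrite iSE.
rewrite -Sl in lt_v; have [iS0 iSE] := hv.2 _ _ S0 Fi0 lt_v.
by rewrite addrC; split=> //; exists i.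
Qed.

Lemma valuation_sum_increasing (F : nat -> R) k :
  (forall h, (h <= k)%N -> F h != 0) ->
  (forall h, (h < k)%N -> v (F h) < v (F h.+1)) ->
  \sum_(h < k.+1) F h != 0 /\ v (\sum_(h < k.+1) F h) = v (F k).
Proof.
elim: k => [|k IHk] F0 vF; first by rewrite big_ord1 F0.
have [|h /ltnW/vF //|S0 Sv] := IHk _; first by move=> h /leqW; exact: F0.
rewrite big_ord_recr /=; apply: hv.2 => //; first exact: F0.
by rewrite Sv vF.
Qed.

Lemma valuation_prod_nat (F : nat -> R) m k :
  (forall h, F h != 0) -> (forall x y : R, x != 0 -> y != 0 -> x * y != 0) ->
  v (\prod_(m <= h < k) F h) = \sum_(m <= h < k) v (F h).
Proof.
move=> F0 domR; suff [] : \prod_(m <= h < k) F h != 0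
  /\ v (\prod_(m <= h < k) F h) = \sum_(m <= h < k) v (F h) by [].
apply: (big_ind2 (fun x e => x != 0 /\ v x = e)).
- by rewrite oner_neq0 valuation1.
- by move=> x e y f [x0 <-] [y0 <-]; rewrite domR // hv.1.
- by [].
Qed.
End ValuationSums.

(** * Gradings of the torus and valuations of its skew field *)

(** A weight of the generators should define a morphism from the torus to the
    Laurent polynomials over [D], with a central variable.  These are realised as
    operators on the functions from the integers to [D]: [monomial a s] multiplies
    by [a] on the left and shifts by [s], and stands for [a] times the [s]-th power
    of the variable. *)
Section SeriesEndomorphisms.
Variable D : unitRingType.

Record series_endo := SeriesEndo {
  endo_fun :> (int -> D) -> (int -> D);
  endoB : zmod_morphism endo_fun
}.

HB.instance Definition _ := gen_eqMixin series_endo.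
HB.instance Definition _ := gen_choiceMixin series_endo.

Lemma series_endoP (f g : series_endo) : (forall v d, f v d = g v d) -> f = g.
Proof.
case: f g => [f fB] [g gB] /= fg.
have {}fg : f = g by apply/funext => v; apply/funext => d.
by rewrite fg in fB *; congr SeriesEndo; exact: Prop_irrelevance.
Qed.

Lemma endo0E (f : series_endo) : f 0 = 0.
Proof. by have := endoB f 0 0; rewrite !subrr. Qed.

Lemma endoDE (f : series_endo) u v : f (u + v) = f u + f v.
Proof. by rewrite -{1}[v]opprK endoB -[- v]sub0r endoB endo0E sub0r opprK. Qed.

Program Definition endo_zero := @SeriesEndo (fun _ => 0) _.
Next Obligation. by move=> u v; rewrite subrr. Qed.

Program Definition endo_one := @SeriesEndo id _.
Next Obligation. by []. Qed.

Program Definition endo_opp (f : series_endo) := @SeriesEndo (fun v => - f v) _.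
Next Obligation. by move=> u v; rewrite endoB opprB opprK addrC. Qed.

Program Definition endo_add (f g : series_endo) :=
  @SeriesEndo (fun v => f v + g v) _.
Next Obligation. by move=> u v; rewrite !endoB opprD addrACA. Qed.

Program Definition endo_mul (f g : series_endo) := @SeriesEndo (fun v => f (g v)) _.
Next Obligation. by move=> u v; rewrite !endoB. Qed.

Fact endo_addA : associative endo_add.
Proof. by move=> f g h; apply: series_endoP => v d /=; rewrite addrA. Qed.
Fact endo_addC : commutative endo_add.
Proof. by move=> f g; apply: series_endoP => v d /=; rewrite addrC. Qed.
Fact endo_add0 : left_id endo_zero endo_add.
Proof. by move=> f; apply: series_endoP => v d /=; rewrite add0r. Qed.
Fact endo_addN : left_inverse endo_zero endo_opp endo_add.
Proof. by move=> f; apply: series_endoP => v d /=; rewrite addNr. Qed.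

HB.instance Definition _ :=
  GRing.isZmodule.Build series_endo endo_addA endo_addC endo_add0 endo_addN.

Fact endo_mulA : associative endo_mul.
Proof. by move=> f g h; apply: series_endoP. Qed.
Fact endo_mul1 : left_id endo_one endo_mul.
Proof. by move=> f; apply: series_endoP. Qed.
Fact endo_mulr1 : right_id endo_one endo_mul.
Proof. by move=> f; apply: series_endoP. Qed.
Fact endo_mulDl : left_distributive endo_mul endo_add.
Proof. by move=> f g h; apply: series_endoP. Qed.
Fact endo_mulDr : right_distributive endo_mul endo_add.
Proof. by move=> f g h; apply: series_endoP => v d /=; rewrite endoDE. Qed.
Fact endo_oner_neq0 : endo_one != endo_zero.
Proof.
apply/eqP => /(congr1 (fun f : series_endo => f (fun=> 1) 0)) /= /eqP.
by rewrite oner_eq0.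
Qed.

HB.instance Definition _ := GRing.Zmodule_isNzRing.Build series_endo
  endo_mulA endo_mul1 endo_mulr1 endo_mulDl endo_mulDr endo_oner_neq0.

Program Definition monomial (a : D) (s : int) :=
  @SeriesEndo (fun v d => a * v (d - s)) _.
Next Obligation. by move=> u v; apply/funext => d; rewrite [LHS]mulrBr. Qed.

Lemma monomialM a b s t : monomial a s * monomial b t = monomial (a * b) (s + t).
Proof.
apply: series_endoP => v d /=; rewrite -mulrA opprD addrA.
by [].
Qed.

Lemma monomial1 : monomial 1 0 = 1.
Proof. by apply: series_endoP => v d /=; rewrite mul1r subr0. Qed.

Lemma monomialX a k : monomial a 0 ^+ k = monomial (a ^+ k) 0.
Proof.
elim: k => [|k IHk]; first by rewrite !expr0 monomial1.
by rewrite !exprS IHk monomialM addr0.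
Qed.

End SeriesEndomorphisms.

Section TorusImages.
Variables (n m : nat) (D : unitRingType).
Variable f : {rmorphism quantum_torus n m -> D}.

Lemma torus_gen_unit u : f (torus_gen u false) \is a GRing.unit.
Proof.
apply/unitrP; exists (f (torus_gen u true)).
by rewrite -!(rmorphM f) torus_Vgen torus_genV rmorph1.
Qed.

Lemma torus_gen_inv u : f (torus_gen u true) = (f (torus_gen u false))^-1.
Proof.
apply: (mulrI (torus_gen_unit u)); rewrite mulrV ?torus_gen_unit //.
by rewrite -(rmorphM f) torus_genV rmorph1.
Qed.

Lemma torus_eps_expE e : f (torus_eps_exp n m e) = f torus_eps ^ e.
Proof.
rewrite torus_eps_expX; case: e => k; rewrite rmorphXn //.
by rewrite torus_gen_inv exprVn.
Qed.
End TorusImages.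

Section Grading.
Variables (n m : nat) (D : unitRingType).
Local Notation T := (quantum_torus n m).
Variable iota : {rmorphism T -> D}.
Hypothesis hD : skew_field_of_fractions iota.
Variable w : qindex n m -> int.

Lemma torus_gen_neq0 u : torus_gen u false != 0 :> T.
Proof.
rewrite -(iota_neq0 hD); apply: contraTneq (torus_gen_unit iota u) => ->.
by rewrite unitr0.
Qed.

Definition letter_weight (x : letter n m) : int :=
  match x with
  | (None, _) => 0
  | (Some y, false) => w y
  | (Some y, true) => - w y
  end.

Definition letter_monomial (x : letter n m) : series_endo D :=
  monomial (iota (torus_gen x.1 x.2)) (letter_weight x).

Lemma grading_action : exists gam : {rmorphism T -> series_endo D},
  forall u b, gam (torus_gen u b) = letter_monomial (u, b).
Proof.
apply: torus_lift.
- move=> u; rewrite monomialM /= -(rmorphM iota) torus_genV rmorph1.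
  by case: u => [x|] /=; rewrite ?subrr ?addr0 monomial1.
- move=> u; rewrite monomialM /= -(rmorphM iota) torus_Vgen rmorph1.
  by case: u => [x|] /=; rewrite ?addNr ?addr0 monomial1.
- move=> [u b]; rewrite /GRing.comm !monomialM /= -!(rmorphM iota) torus_gen_central.
  by rewrite addrC.
- move=> x y e qe; rewrite /letter_monomial /=.
  have -> : match e with
     | Posz k => monomial (iota (torus_gen None false)) 0 ^+ k
     | Negz k => monomial (iota (torus_gen None true)) 0 ^+ k.+1
     end = monomial (iota (torus_eps_exp n m e)) 0.
    by rewrite torus_eps_expX; case: e {qe} => k; rewrite monomialX rmorphXn.
  rewrite !monomialM -!(rmorphM iota) (torus_gen_qcomm qe) add0r addrC.
  by [].
Qed.

(** The image in the torus of the Laurent polynomials in eps. *)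
Inductive torus_laurent : T -> Prop :=
| torus_laurent0 : torus_laurent 0
| torus_laurentB x y of torus_laurent x & torus_laurent y : torus_laurent (x - y)
| torus_laurentX e : torus_laurent (torus_eps_exp n m e).

(** [comp x d] is the component of weight [d] of [x].  It is the coefficient of the
    variable to the power [d] in the Laurent polynomial of [x], read off by letting
    [x] act on the indicator function of 0. *)
Lemma grading_components : exists comp : T -> int -> D,
  [/\ forall x y d, comp (x - y) d = comp x d - comp y d,
      forall x, exists2 S : seq int, uniq S &
        [/\ forall d, d \notin S -> comp x d = 0,
            iota x = \sum_(e <- S) comp x e &
            forall y d, comp (x * y) d = \sum_(e <- S) comp x e * comp y (d - e)],
      forall c d, torus_laurent c -> d != 0 -> comp c d = 0 &
      forall x d, d != w x -> comp (torus_gen (Some x) false) d = 0].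
Proof.
have [gam gamE] := grading_action.
pose delta (d : int) : D := (d == 0)%:R.
pose comp x d := gam x delta d.
(* Every element acts as a finite sum of monomials, possibly with repeated
   weights; regrouping them by weight yields the components. *)
have gam_sum x : exists s : seq (int * D),
    iota x = \sum_(c <- s) c.2 /\
    forall v d, gam x v d = \sum_(c <- s) c.2 * v (d - c.1).
  elim/torus_ind: x => [|x y [s [sx sv]] [t [tx tv]]|u b x [s [sx sv]]].
  - by exists [:: (0, 1)]; rewrite !rmorph1 big_seq1; split=> // v d;
      rewrite big_seq1 subr0 mul1r.
  - exists (s ++ [seq (c.1, - c.2) | c <- t]).
    rewrite rmorphB sx tx big_cat big_map sumrN; split=> // v d.
    rewrite rmorphB /= big_cat big_map -sv /=; congr (_ + _).
    rewrite [LHS](_ : _ = - gam y v d) // tv -sumrN.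
    by apply: eq_bigr => c _; rewrite mulNr.
  - exists [seq (letter_weight (u, b) + c.1, iota (torus_gen u b) * c.2) | c <- s].
    rewrite rmorphM sx big_map -mulr_sumr; split=> // v d.
    rewrite rmorphM gamE /= sv mulr_sumr big_map; apply: eq_bigr => c _ /=.
    by rewrite mulrA opprD addrA.
have comp_sum x : exists2 S : seq int, uniq S &
    [/\ forall d, d \notin S -> comp x d = 0,
        iota x = \sum_(e <- S) comp x e &
        forall v d, gam x v d = \sum_(e <- S) comp x e * v (d - e)].
  have [s [sx sv]] := gam_sum x; pose S := undup [seq c.1 | c <- s].
  have US : uniq S by exact: undup_uniq.
  have compE d : comp x d = \sum_(c <- s | c.1 == d) c.2.
    rewrite /comp sv [RHS]big_mkcond; apply: eq_bigr => c _.
    rewrite /delta subr_eq0 eq_sym.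
    by case: eqP; rewrite ?mulr1 ?mulr0.
  have regroup (F : int * D -> D) :
      \sum_(c <- s) F c = \sum_(e <- S) \sum_(c <- s | c.1 == e) F c.
    rewrite (exchange_big_dep predT) //= big_seq [RHS]big_seq.
    apply: eq_bigr => c cs; rewrite -big_filter.
    have cS : c.1 \in S by rewrite mem_undup map_f.
    have eqP1 : (fun e => c.1 == e) =1 pred1 c.1 by move=> e; rewrite /= eq_sym.
    by rewrite (eq_filter eqP1) filter_pred1_uniq // big_seq1.
  exists S => //; split.
  - move=> d dS; rewrite compE big1_seq // => c /andP[/eqP cd cs].
    by case/negP: dS; rewrite -cd mem_undup map_f.
  - by rewrite sx regroup; apply: eq_bigr => e _; rewrite compE.
  - move=> v d; rewrite sv regroup; apply: eq_bigr => e _.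
    by rewrite compE mulr_suml; apply: eq_bigr => c /eqP ->.
exists comp; split.
- by move=> x y d; rewrite /comp rmorphB.
- move=> x; have [S US [S0 Sx Sv]] := comp_sum x; exists S => //; split=> //.
  by move=> y d; rewrite /comp rmorphM /= Sv.
- move=> c d; elim=> [|x y _ IHx _ IHy|e] d0.
  + by rewrite /comp rmorph0.
  + by rewrite /comp rmorphB /= [LHS](_ : _ = comp x d - comp y d) // IHx // IHy // subrr.
  + have -> : comp (torus_eps_exp n m e) d
              = monomial (iota (torus_eps_exp n m e)) 0 delta d.
      rewrite /comp torus_eps_expX; congr (endo_fun _ _ _).
      by case: e => k; rewrite !rmorphXn -monomialX gamE.
    by rewrite /= /delta subr0 (negPf d0) mulr0.
- move=> x d dx; rewrite /comp gamE /= /delta subr_eq0 (negPf dx).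
  by rewrite mulr0.
Qed.

Lemma int_seq_max (S : seq int) (P : pred int) : has P S ->
  exists2 a, P a & forall e, e \in S -> P e -> e <= a.
Proof.
elim: S => // x S IHS /=; have [/IHS [a Pa aM] _|noS] := boolP (has P S).
  have [xa|ax] := leP x a.
    by exists a => // e; rewrite inE => /predU1P[-> //|]; exact: aM.
  have [Px|nPx] := boolP (P x).
    exists x => // e; rewrite inE => /predU1P[-> //|eS Pe].
    exact: le_trans (aM _ eS Pe) (ltW ax).
  exists a => // e; rewrite inE => /predU1P[->|]; last exact: aM.
  by rewrite (negPf nPx).
rewrite orbF => Px; exists x => // e; rewrite inE => /predU1P[-> //|eS Pe].
by case/hasP: noS; exists e.
Qed.

(** On the torus, the valuation is the largest weight of a nonzero component: the
    component of that weight of a product is the product of the leading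
    components, which is nonzero in a skew field. *)
Lemma weight_valuation : exists V : D -> int, [/\ valuation V,
   forall x, V (iota (torus_gen (Some x) false)) = w x &
   forall c, torus_laurent c -> c != 0 -> V (iota c) = 0].
Proof.
have [comp [compB compS compL compG]] := grading_components.
pose hasdeg x a := comp x a != 0 /\ forall e, a < e -> comp x e = 0.
have degP x : exists a, x != 0 -> hasdeg x a.
  have [S US [S0 Sx _]] := compS x.
  have [/int_seq_max [a ca aM]|noS] := boolP (has (fun e => comp x e != 0) S).
    exists a => _; split=> // e ae; apply: contraTeq ae => ce; rewrite -leNgt.
    by apply: aM => //; apply: contraNT ce => /S0 ->.
  exists 0 => x0; case/negP: x0; rewrite -(negbK (x == 0)) -(iota_neq0 hD) negbK.
  rewrite Sx big1_seq ?eqxx // => e /andP[_ eS].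
  by apply: contraNeq noS => ce; apply/hasP; exists e.
have [v vP] := choice degP.
have deg_uniq x a : x != 0 -> hasdeg x a -> v x = a.
  move=> /vP [cv vM] [ca aM]; apply/eqP; rewrite eq_le !leNgt.
  apply/andP; split; apply/negP => lt_av.
    by rewrite aM ?eqxx in cv.
  by rewrite vM ?eqxx in ca.
have valv : valuation v.
  split=> x y x0 y0; have [cx vx] := vP _ x0; have [cy vy] := vP _ y0.
    apply: deg_uniq; first exact: T_mulf_neq0 hD _ _ x0 y0.
    have [S US [S0 _ Sy]] := compS x.
    have vxS : v x \in S by apply: contraNT cx => /S0 ->.
    split=> [|d lt_d]; rewrite Sy.
      rewrite (bigD1_seq _ vxS US) /= addrAC subrr add0r big1 ?addr0.
        exact: D_mulf_neq0 hD _ _ cx cy.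
      move=> e; rewrite neq_lt => /orP[lt_e|lt_e]; last by rewrite vx ?mul0r.
      by rewrite vy ?mulr0 //; lia.
    rewrite big1 // => e _; have [le_e|lt_e] := leP e (v x).
      by rewrite vy ?mulr0 //; lia.
    by rewrite vx ?mul0r.
  have comp0 d : comp 0 d = 0 by have := compB 0 0 d; rewrite !subrr.
  have compD a b d : comp (a + b) d = comp a d + comp b d.
    by rewrite -{1}[b]opprK compB -[- b]sub0r compB comp0 sub0r opprK.
  move=> lt_v; have hdeg : hasdeg (x + y) (v y).
    split=> [|e lt_e]; rewrite compD vx ?add0r //; last exact: lt_trans lt_e.
    by rewrite vy.
  have xy0 : x + y != 0.
    by apply: contraTneq hdeg.1 => ->; rewrite negbK comp0.
  by split=> //; exact: deg_uniq.
have [V valV VE] := extend_valuation hD valv.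
have single x a : x != 0 -> (forall d, d != a -> comp x d = 0) -> v x = a.
  move=> x0 xa; apply/eqP/negPn/negP => /xa; have [cx _] := vP _ x0.
  by move/eqP; rewrite (negPf cx).
exists V; split=> // [x|c cL c0].
  have g0 := torus_gen_neq0 (Some x).
  by rewrite VE //; apply: single => // d; exact: compG.
by rewrite VE //; apply: single => // d; exact: compL.
Qed.

End Grading.

(** * The defining relations as a single exponent *)
Section Exponents.
Variables n m : nat.
Hypothesis n_ge3 : (2 < n)%N.
Local Notation qindex := (qindex n m).

Definition snake_index (x : qindex) : 'Z_n := x.2 + (x.1.+1)%:R.

(** The pairs of generators that are not covered directly, but after exchange of
    their members, get the opposite exponent; this makes the exponent
    antisymmetric and defined for all pairs. *)
Definition qexponent (x y : qindex) : int :=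
  let s := snake_index x - snake_index y in
  if x.1 == y.1 then row_exponent s
  else let e := kron (s - 1) - kron s *+ 2 + kron (s + 1) in
       if (x.1 < y.1)%N then e else - e.

Lemma mem_snake (x : qindex) k : (x \in snake m k) = (snake_index x == 1 + k).
Proof. by rewrite inE. Qed.

Lemma qexponent_anti x y : qexponent y x = - qexponent x y.
Proof.
rewrite /qexponent -(opprB (snake_index x)) eq_sym; set s := snake_index x - _.
have [_|ne] := eqVneq x.1 y.1; first by rewrite row_exponentN /row_exponent opprB.
have -> : - s - 1 = - (s + 1) by ring.
have -> : - s + 1 = - (s - 1) by ring.
rewrite !kronN; move: ne; rewrite -(inj_eq val_inj) /=.
by case: ltngtP => // _ _; ring.
Qed.

Lemma snake_step x y k : x \in snake m (k + 1) -> y \in snake m k ->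
  snake_index x - snake_index y = 1.
Proof. by rewrite !mem_snake => /eqP -> /eqP ->; ring. Qed.

Lemma snake_same x y k : x \in snake m k -> y \in snake m k ->
  snake_index x - snake_index y = 0.
Proof. by rewrite !mem_snake => /eqP -> /eqP ->; ring. Qed.

Lemma ltn_row_neq (x y : qindex) : (x.1 < y.1)%N -> (x.1 == y.1) = false.
Proof. by move=> lt_xy; apply/negP => /eqP E; rewrite E ltnn in lt_xy. Qed.

Lemma qcomm_case_exponent x y e : qcomm_case x y e -> e = qexponent x y.
Proof.
have two : 1 + 1 = 2 :> 'Z_n by ring.
case=> k xk yk; rewrite /qexponent.
- rewrite (snake_step xk yk) leq_eqVlt (inj_eq val_inj) subrr two.
  rewrite /row_exponent subrr two kron_0 (kron_1 n_ge3) (kron_2 n_ge3).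
  by case: eqP => //= _ ->.
- rewrite (snake_step xk yk) subrr two kron_0 (kron_1 n_ge3) (kron_2 n_ge3) => lt_yx.
  by rewrite eq_sym (ltn_row_neq lt_yx) ltnNge (ltnW lt_yx).
- rewrite (snake_same xk yk) sub0r add0r kronN kron_0 (kron_1 n_ge3) => lt_xy.
  by rewrite (ltn_row_neq lt_xy) lt_xy.
- rewrite (snake_same xk yk) sub0r add0r kronN kron_0 (kron_1 n_ge3) => lt_yx.
  by rewrite eq_sym (ltn_row_neq lt_yx) ltnNge (ltnW lt_yx).
Qed.

Lemma qcomm_case_step x y : snake_index x - snake_index y = 1 ->
  exists e, qcomm_case x y e.
Proof.
move=> s1; have yk : y \in snake m (snake_index y - 1).
  by rewrite mem_snake addrC subrK.
have xk : x \in snake m (snake_index y - 1 + 1).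
  by rewrite mem_snake subrK -s1 subrK.
have [le_xy|lt_yx] := leqP x.1 y.1.
  by exists 1; exact: QCommStepLe xk yk le_xy.
by exists (-1); exact: QCommStepGt xk yk lt_yx.
Qed.

Lemma qcomm_case_same x y : snake_index x - snake_index y = 0 -> x.1 != y.1 ->
  exists e, qcomm_case x y e.
Proof.
move=> s0 ne; have yk : y \in snake m (snake_index y - 1).
  by rewrite mem_snake addrC subrK.
have xk : x \in snake m (snake_index y - 1).
  by rewrite mem_snake addrC subrK -subr_eq0 s0.
have := ne; rewrite -(inj_eq val_inj) neq_ltn => /orP[lt_xy|lt_yx].
  by exists (-2); exact: QCommSameLt xk yk lt_xy.
by exists 2; exact: QCommSameGt xk yk lt_yx.
Qed.

(** Since [n] is at least 3, the differences 1, 0 and -1 of snake indices are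
    distinct, so that the cases of the relations are mutually exclusive. *)
Lemma qcommE x y e : qcomm x y e -> e = qexponent x y.
Proof.
case=> [f /qcomm_case_exponent //|nxy nyx]; rewrite /qexponent.
set s := snake_index x - snake_index y.
have s1 : s - 1 == 0 = false.
  apply/negP; rewrite subr_eq0 => /eqP /qcomm_case_step [f]; exact: nxy.
have sN1 : s + 1 == 0 = false.
  apply/negP; rewrite addr_eq0 => /eqP E.
  have /qcomm_case_step [f] : snake_index y - snake_index x = 1.
    by rewrite -opprB -/s E opprK.
  exact: nyx.
have [_|ne] := eqVneq; first by rewrite /row_exponent /kron s1 sN1.
have s0 : s == 0 = false.
  by apply/negP => /eqP /qcomm_case_same /(_ ne) [f]; exact: nxy.
by rewrite /kron s0 s1 sN1; case: ifP.
Qed.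

Lemma qcomm_or_sym (x y : qindex) :
  (exists e, qcomm x y e) \/ (exists e, qcomm y x e).
Proof.
have [[e xye]|nxy] := pselect (exists e, qcomm_case x y e).
  by left; exists e; exact: QCommCase.
have [[e yxe]|nyx] := pselect (exists e, qcomm_case y x e).
  by right; exists e; exact: QCommCase.
left; exists 0; apply: QCommNone => e xye; [apply: nxy|apply: nyx]; by exists e.
Qed.

Lemma commutation_relationsP (D : unitRingType) (eps : D) (q : 'I_m -> 'Z_n -> D) :
  eps \is a GRing.unit ->
  commutation_relations eps q <->
  forall x y : qindex, qcommute eps (q x.1 x.2) (q y.1 y.2) (qexponent x y).
Proof.
move=> eps_unit; split=> [rel x y|rel x y e /qcommE ->]; last exact: rel.
have [[e xye]|[e yxe]] := qcomm_or_sym x y.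
  by rewrite -(qcommE xye); exact: rel.
rewrite -[qexponent x y]opprK -qexponent_anti -(qcommE yxe).
by apply: (qcommute_sym eps_unit); exact: rel.
Qed.

End Exponents.

(** * Monomial normal form *)
Section NormalForm.
Variables (n m : nat) (D : unitRingType).
Hypothesis n_ge3 : (2 < n)%N.
Local Notation T := (quantum_torus n m).
Local Notation qindex := (qindex n m).
Variable iota : {rmorphism T -> D}.
Hypothesis hD : skew_field_of_fractions iota.
Local Notation eps := (iota torus_eps).
Local Notation tq x := (torus_gen (Some x) false : T).

Lemma eps_unit : eps \is a GRing.unit.
Proof. exact: (torus_gen_unit iota None). Qed.

Lemma torus_eps_comm (x : T) : GRing.comm (torus_eps : T) x.
Proof.
elim/torus_ind: x => [|x y cx cy|u b x cx]; first exact: commr1.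
  exact: commrB.
by apply: commrM cx; exact: torus_gen_central.
Qed.

Lemma eps_central (x : D) : GRing.comm eps x.
Proof.
have [a [b [b0 ->]]] := skew_field_frac hD x.
have epsC c : GRing.comm eps (iota c).
  by rewrite /GRing.comm -!rmorphM torus_eps_comm.
by apply: commrM; last apply: commrV.
Qed.

Lemma torus_commutation (f : {rmorphism T -> D}) :
  commutation_relations (f torus_eps) (fun l i => f (tq (l, i))).
Proof.
move=> [x1 x2] [y1 y2] e /torus_gen_qcomm E /=.
by rewrite -rmorphM E !rmorphM torus_eps_expE.
Qed.

Definition ordered_monomial (f : {rmorphism T -> D}) (s : seq qindex)
    (a : {ffun qindex -> int}) : D :=
  \prod_(x <- s) f (tq x) ^ a x.

(** A power of a generator can be moved to its place in an ordered monomial.  The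
    power of eps that this produces does not depend on the morphism [f], which is
    why the quantifier over [f] comes last. *)
Lemma gen_ordered_monomial (s : seq qindex) y (sg : int)
    (a : {ffun qindex -> int}) : uniq s -> y \in s ->
  exists k, forall f : {rmorphism T -> D}, f torus_eps = eps ->
    f (tq y) ^ sg * ordered_monomial f s a
    = eps ^ k * ordered_monomial f s [ffun x => a x + sg * (x == y)%:R].
Proof.
elim: s => // x s IHs /= /andP[xNs Us]; rewrite inE.
have [->|ne_yx] := eqVneq y x => /= ys.
  exists 0 => f feps; rewrite /ordered_monomial !big_cons expr0z mul1r.
  rewrite ffunE eqxx mulr1 mulrA -exprzDr ?torus_gen_unit // addrC; congr (_ * _).
  rewrite !big_seq; apply: eq_bigr => z zs; rewrite ffunE.
  have -> : (z == x) = false by apply: contraNF xNs => /eqP <-.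
  by rewrite mulr0 addr0.
have [k kP] := IHs Us ys.
pose e := qexponent y x * a x * sg.
exists (e + k) => f feps; rewrite /ordered_monomial !big_cons.
rewrite ffunE eq_sym (negPf ne_yx) mulr0 addr0.
have qyx : qcommute eps (f (tq y)) (f (tq x)) (qexponent y x).
  have := torus_commutation f; rewrite feps.
  move=> /(commutation_relationsP n_ge3 _ eps_unit) /(_ y x).
  by case: y x {ne_yx xNs ys k kP e IHs} => [? ?] [? ?].
have qX : qcommute eps (f (tq y) ^ sg) (f (tq x) ^ a x) e.
  have uf z := torus_gen_unit f (Some z).
  have qXr := qcommuteXr eps_unit eps_central.
  have := qXr _ _ _ sg (uf y) (qcommute_sym eps_unit (qXr _ _ _ (a x) (uf x) qyx)).
  by move=> /(qcommute_sym eps_unit); rewrite mulNr opprK.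
rewrite mulrA qX -!mulrA (kP f feps) !mulrA.
by rewrite -(mulrA (eps ^ e)) (epsX_central eps_central) mulrA -(epsXD eps_unit).
Qed.

Lemma torus_eps_expD e k :
  torus_eps_exp n m e * torus_eps_exp n m k = torus_eps_exp n m (e + k).
Proof.
apply: (skew_field_inj hD); rewrite rmorphM !torus_eps_expE.
by rewrite (epsXD eps_unit).
Qed.

Lemma torus_laurentN (c : T) : torus_laurent c -> torus_laurent (- c).
Proof.
by move=> cL; rewrite -sub0r; apply: torus_laurentB => //; exact: torus_laurent0.
Qed.

Lemma torus_laurentMX (c : T) k : torus_laurent c ->
  torus_laurent (torus_eps_exp n m k * c).
Proof.
elim=> [|x y _ xL _ yL|e]; first by rewrite mulr0; exact: torus_laurent0.
  by rewrite mulrBr; exact: torus_laurentB.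
by rewrite torus_eps_expD; exact: torus_laurentX.
Qed.

Lemma torus_laurent_sum (I : Type) (s : seq I) (P : pred I) (F : I -> T) :
  (forall i, P i -> torus_laurent (F i)) -> torus_laurent (\sum_(i <- s | P i) F i).
Proof.
move=> FL; apply: big_ind => //; first exact: torus_laurent0.
move=> x y xL yL; rewrite -[y]opprK.
by apply: torus_laurentB => //; exact: torus_laurentN.
Qed.

Lemma torus_laurentE (f : {rmorphism T -> D}) c : f torus_eps = eps ->
  torus_laurent c -> f c = iota c.
Proof.
move=> feps; elim=> [|x y _ xE _ yE|e]; first by rewrite !rmorph0.
  by rewrite !rmorphB xE yE.
by rewrite !torus_eps_expE feps.
Qed.

Lemma torus_laurent_central c x : torus_laurent c -> GRing.comm (iota c) x.
Proof.
elim=> [|y z _ yC _ zC|e].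
- by rewrite rmorph0; exact/commr_sym/commr0.
- by rewrite rmorphB; apply/commr_sym/commrB; exact/commr_sym.
- by rewrite torus_eps_expE /GRing.comm (epsX_central eps_central).
Qed.

Local Notation idx := (enum {: qindex}).

Lemma normal_form_list (x : T) :
  exists s : seq (T * {ffun qindex -> int}),
    (forall c, c \in s -> torus_laurent c.1) /\
    forall f : {rmorphism T -> D}, f torus_eps = eps ->
      f x = \sum_(c <- s) f c.1 * ordered_monomial f idx c.2.
Proof.
elim/torus_ind: x => [|x y [s [sL sE]] [t [tL tE]]|u b x [s [sL sE]]].
- exists [:: (torus_eps_exp n m 0, [ffun=> 0])]; split.
    by move=> c; rewrite inE => /eqP ->; exact: torus_laurentX.
  move=> f feps; rewrite big_seq1 torus_eps_expE expr0z mul1r.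
  by rewrite /ordered_monomial big1 // => z _; rewrite ffunE expr0z.
- exists (s ++ [seq (- c.1, c.2) | c <- t]); split.
    move=> c; rewrite mem_cat => /orP[/sL //|/mapP [d /tL dL ->]].
    exact: torus_laurentN.
  move=> f feps; rewrite rmorphB sE // tE // big_cat big_map -sumrN; congr (_ + _).
  by apply: eq_bigr => c _; rewrite rmorphN mulNr.
case: u => [y|]; last first.
  pose k : int := if b then -1 else 1.
  exists [seq (torus_eps_exp n m k * c.1, c.2) | c <- s]; split.
    by move=> _ /mapP [d /sL dL ->]; exact: torus_laurentMX.
  move=> f feps; rewrite rmorphM sE // mulr_sumr big_map; apply: eq_bigr => c _.
  rewrite rmorphM mulrA; congr (_ * _ * _); rewrite torus_eps_expE /k.
  by case: b {k}; rewrite // torus_gen_inv.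
pose sg : int := if b then -1 else 1.
have step a := gen_ordered_monomial sg a (enum_uniq _) (mem_enum predT y).
have [k kP] := choice step.
pose act (c : T * {ffun qindex -> int}) :=
  (torus_eps_exp n m (k c.2) * c.1, [ffun x => c.2 x + sg * (x == y)%:R]).
exists [seq act c | c <- s]; split.
  by move=> _ /mapP [d /sL dL ->]; exact: torus_laurentMX.
move=> f feps; rewrite rmorphM sE // mulr_sumr big_map big_seq [RHS]big_seq.
apply: eq_bigr => c cs; rewrite /act /= rmorphM torus_eps_expE feps.
have -> : f (torus_gen (Some y) b) = f (tq y) ^ sg.
  by rewrite /sg; case: b {sg step k kP act}; rewrite // torus_gen_inv.
rewrite -mulrA (mulrA _ (f c.1)) (torus_laurentE feps (sL _ cs)).
rewrite -(torus_laurent_central _ (sL _ cs)) -mulrA kP // !mulrA.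
by rewrite (epsX_central eps_central).
Qed.

(** One expression of [x] serves for all morphisms that fix eps, in particular for
    the inclusion in [D] and for the morphism to be shown injective; it also shows
    that a morphism is determined by the images of the generators. *)
Lemma normal_form (x : T) :
  exists (A : seq {ffun qindex -> int}) (C : {ffun qindex -> int} -> T),
  [/\ uniq A, forall a, torus_laurent (C a) &
    forall f : {rmorphism T -> D}, f torus_eps = eps ->
      f x = \sum_(a <- A) iota (C a) * ordered_monomial f idx a].
Proof.
have [s [sL sE]] := normal_form_list x.
pose A := undup [seq c.2 | c <- s].
exists A, (fun a => \sum_(c <- s | (c \in s) && (c.2 == a)) c.1); split.
- exact: undup_uniq.
- by move=> a; apply: torus_laurent_sum => c /andP[/sL].
move=> f feps; rewrite sE //.
have -> : \sum_(c <- s) f c.1 * ordered_monomial f idx c.2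
   = \sum_(a <- A) \sum_(c <- s | (c \in s) && (c.2 == a))
       f c.1 * ordered_monomial f idx c.2.
  rewrite (exchange_big_dep (fun c => c \in s)) //=; last by move=> ? ? _ /andP[].
  rewrite big_seq; apply: eq_bigr => c cs; rewrite -big_filter cs /=.
  have cA : c.2 \in A by rewrite mem_undup map_f.
  have eqP1 : (fun e => c.2 == e) =1 pred1 c.2 by move=> e; rewrite /= eq_sym.
  by rewrite (eq_filter eqP1) filter_pred1_uniq ?undup_uniq // big_seq1.
apply: eq_bigr => a _; rewrite rmorph_sum mulr_suml; apply: eq_bigr => c.
by case/andP=> /sL cL /eqP ->; rewrite (torus_laurentE feps cL).
Qed.
End NormalForm.

(** * Generic weights *)
Section GenericWeights.
Variables (n m : nat) (j j1 : 'I_m).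
Hypothesis ne_j : j1 != j.
Local Notation qindex := (qindex n m).
Implicit Types (w d : qindex -> int).

(** The valuation of the images of the generators, in terms of the weights of the
    generators, when row [j] is heavier than row [j1]; see [p_image_valuation] and
    [q_image_valuation]. *)
Definition image_weight w (x : qindex) : int :=
  if x.1 == j then w (j, x.2) + w (j1, x.2) - w (j, x.2 + 1)
  else if x.1 == j1 then w (j, x.2 + 1) else w x.

(** The transpose of [image_weight], acting on exponents. *)
Definition dual_weight d (x : qindex) : int :=
  if x.1 == j then d (j, x.2) - d (j, x.2 - 1) + d (j1, x.2 - 1)
  else if x.1 == j1 then d (j, x.2) else d x.

Lemma sum_two_rows (F : qindex -> int) :
  \sum_x F x = \sum_i (F (j, i) + F (j1, i))
    + \sum_(l | (l != j) && (l != j1)) \sum_i F (l, i).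
Proof.
transitivity (\sum_l \sum_i F (l, i)).
  by rewrite pair_bigA; apply: eq_bigr => -[].
by rewrite (bigD1 j) //= (bigD1 j1) //= addrA big_split.
Qed.

Lemma sum_Zn_shift (F : 'Z_n -> int) : \sum_i F (i + 1) = \sum_i F i.
Proof. by rewrite [RHS](reindex_inj (addIr 1)). Qed.

Lemma image_weight_dual w d :
  \sum_x d x * image_weight w x = \sum_x dual_weight d x * w x.
Proof.
rewrite !sum_two_rows; congr (_ + _); last first.
  apply: eq_bigr => l /andP[lj lj1]; apply: eq_bigr => i _.
  by rewrite /image_weight /dual_weight /= (negPf lj) (negPf lj1).
rewrite /image_weight /dual_weight /= eqxx (negPf ne_j) eqxx.
pose G i := (d (j1, i - 1) - d (j, i - 1)) * w (j, i).
transitivity (\sum_i (d (j, i) * w (j, i) + d (j, i) * w (j1, i))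
              + \sum_i G (i + 1)).
  by rewrite -big_split; apply: eq_bigr => i _; rewrite /G /= addrK; ring.
rewrite sum_Zn_shift -big_split; apply: eq_bigr => i _.
by rewrite /G /=; ring.
Qed.

Lemma dual_weight_inj d : (forall x, dual_weight d x = 0) -> forall x, d x = 0.
Proof.
move=> d0; have dj i : d (j, i) = 0.
  by have := d0 (j1, i); rewrite /dual_weight /= (negPf ne_j) eqxx.
have dj1 i : d (j1, i) = 0.
  by have := d0 (j, i + 1); rewrite /dual_weight /= eqxx addrK !dj subrr add0r.
case=> l i; have [/eqP->|lj] := boolP (l == j); first exact: dj.
have [/eqP->|lj1] := boolP (l == j1); first exact: dj1.
by have := d0 (l, i); rewrite /dual_weight /= (negPf lj) (negPf lj1).
Qed.

Lemma int_poly_nonroot (P : {poly int}) : P != 0 ->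
  exists t : nat, (1 < t)%N /\ P.[t%:Z] != 0.
Proof.
move=> P0; pose rs := [seq k%:Z | k <- iota 2 (size P)].
have [allroot|/allPn [r /mapP[t ts ->] Pt]] := boolP (all (root P) rs).
  have rs_uniq : uniq rs by rewrite map_inj_uniq ?iota_uniq // => ? ? [].
  by have := max_poly_roots P0 allroot rs_uniq; rewrite size_map size_iota ltnn.
by exists t; move: ts; rewrite mem_iota => /andP[].
Qed.

(** The weights are the powers of an integer [t] with distinct exponents, larger on
    row [j] than elsewhere.  Each sum is then the value at [t] of a nonzero
    polynomial, and [t] can be chosen outside of the roots of all of them. *)
Lemma generic_weight (L : seq {ffun qindex -> int}) :
  (forall b, b \in L -> exists x, b x != 0) ->
  exists w : qindex -> int, (forall i i', w (j1, i) < w (j, i')) /\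
    forall b, b \in L -> \sum_x b x * w x != 0.
Proof.
move=> L0; pose N := #|{: qindex}|.
(* The shift by N puts the exponents of row j above all the others. *)
pose k (x : qindex) := (enum_rank x + (x.1 == j) * N)%N.
have k_inj : injective k.
  move=> x y; rewrite /k => kxy; apply/enum_rank_inj/val_inj => /=.
  have := ltn_ord (enum_rank x); have := ltn_ord (enum_rank y).
  move: kxy; rewrite -/N; case: (x.1 == j); case: (y.1 == j);
    rewrite ?mul1n ?mul0n; lia.
pose P (b : {ffun qindex -> int}) : {poly int} := \sum_x b x *: 'X^(k x).
have P0 b : b \in L -> P b != 0.
  move=> /L0 [x bx]; apply: contraNneq bx => Pb0.
  have := congr1 (fun p : {poly int} => p`_(k x)) Pb0; rewrite coef0 coef_sum.
  rewrite (bigD1 x) //= coefZ coefXn eqxx mulr1 big1 ?addr0 => [->//|y ne_yx].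
  by rewrite coefZ coefXn (inj_eq k_inj) eq_sym (negPf ne_yx) mulr0.
have [|t [t_gt1 tP]] := @int_poly_nonroot (\prod_(b <- L) P b).
  by rewrite prodf_seq_neq0; apply/allP => b bL; rewrite /= P0.
exists (fun x => (t ^ k x)%:Z); split=> [i i'|b bL].
  rewrite ltz_nat ltn_exp2l // /k /= eqxx (negPf ne_j) mul1n mul0n addn0.
  exact: leq_trans (ltn_ord _) (leq_addl _ _).
have : (P b).[t%:Z] != 0.
  apply: contraNneq tP => Pb0; rewrite horner_prod.
  by rewrite (big_rem b) //= Pb0 mul0r.
rewrite /P horner_sum; congr (_ != 0); apply: eq_bigr => x _.
by rewrite hornerZ hornerXn -!natz natrX.
Qed.

Lemma separating_weight (B : seq {ffun qindex -> int}) :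
  exists w : qindex -> int, (forall i i', w (j1, i) < w (j, i')) /\
    {in B &, injective (fun a : {ffun qindex -> int} =>
       \sum_x a x * image_weight w x)}.
Proof.
pose dif (a b : {ffun qindex -> int}) : {ffun qindex -> int} :=
  [ffun x => dual_weight (fun y => a y - b y) x].
pose L := [seq c <- [seq dif a b | a <- B, b <- B] | c != [ffun=> 0]].
have [|w [w_lt wL]] := @generic_weight L.
  move=> c; rewrite mem_filter => /andP[c0 _]; apply/existsP; apply: contraNT c0.
  move=> /existsPn c0; apply/eqP/ffunP => x; rewrite ffunE.
  by apply/eqP/negPn/c0.
exists w; split=> // a b aB bB ab; apply/eqP/negPn/negP => ne_ab.
have: \sum_x dif a b x * w x != 0.
  apply: wL; rewrite mem_filter allpairs_f // andbT; apply: contra_neq ne_ab => d0.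
  apply/ffunP => x; apply/eqP; rewrite -subr_eq0; apply/eqP.
  apply: (@dual_weight_inj (fun y => a y - b y)) => y.
  by have := congr1 (fun c : {ffun qindex -> int} => c y) d0; rewrite !ffunE.
rewrite (eq_bigr (fun x => dual_weight (fun y => a y - b y) x * w x)); last first.
  by move=> x _; rewrite ffunE.
rewrite -image_weight_dual (eq_bigr (fun x =>
  a x * image_weight w x - b x * image_weight w x)); last first.
  by move=> x _; rewrite mulrBl.
by rewrite sumrB ab subrr eqxx.
Qed.
End GenericWeights.

(** * Valuations of the images *)
Section KappaValuation.
Variables (D : unitRingType) (V : D -> int).
Hypothesis valV : valuation V.
Hypothesis D_unit : forall x : D, x != 0 -> x \is a GRing.unit.
Hypothesis D_dom : forall x y : D, x != 0 -> y != 0 -> x * y != 0.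

Lemma valuationV x : x != 0 -> V x^-1 = - V x.
Proof.
move=> x0; have xV0 : x^-1 != 0.
  by apply: contraNneq x0 => xV0; rewrite -[x]invrK xV0 invr0.
have := valV.1 _ _ x0 xV0; rewrite mulrV ?D_unit // (valuation1 valV).
by move: (V x) (V x^-1) => a b; lia.
Qed.

Lemma expz_neq0 (x : D) k : x != 0 -> x ^ k != 0.
Proof.
move=> x0; apply: contraTneq (unitrXz k (D_unit x0)) => ->.
by rewrite unitr0.
Qed.

Lemma valuationX (x : D) k : x != 0 -> V (x ^ k) = k * V x.
Proof.
move=> x0; have VXn i : V (x ^+ i) = i%:Z * V x.
  elim: i => [|i IHi]; first by rewrite expr0 mul0r (valuation1 valV).
  have xi0 : x ^+ i != 0 := expz_neq0 i x0.
  by rewrite exprS valV.1 // IHi intS mulrDl mul1r.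
case: k => k; first exact: VXn.
have xk0 : x ^+ k.+1 != 0 := expz_neq0 k.+1 x0.
by rewrite NegzE mulNr -VXn; exact: valuationV.
Qed.

Lemma valuation_prodX (I : Type) (s : seq I) (F : I -> D) (a : I -> int) :
  (forall i, F i != 0) ->
  \prod_(i <- s) F i ^ a i != 0 /\
  V (\prod_(i <- s) F i ^ a i) = \sum_(i <- s) a i * V (F i).
Proof.
move=> F0; apply: (big_ind2 (fun x e => x != 0 /\ V x = e)).
- by rewrite oner_neq0 (valuation1 valV).
- by move=> x e y f [x0 <-] [y0 <-]; rewrite D_dom // valV.1.
- by move=> i _; rewrite expz_neq0 // valuationX.
Qed.

Variables (n : nat) (p q : 'Z_n -> D).
Hypothesis n_ge3 : (2 < n)%N.
Hypothesis p_neq0 : forall i, p i != 0.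
Hypothesis q_neq0 : forall i, q i != 0.
Hypothesis pq_lt : forall i k, V (q i) < V (p k).

Lemma prod_nat_neq0 (F : nat -> D) a b : (forall h, F h != 0) ->
  \prod_(a <= h < b) F h != 0.
Proof.
move=> F0; apply: (big_ind (fun x : D => x != 0)) => //.
exact: oner_neq0.
Qed.

(** Passing from one term of kappa to the next trades a factor q for a factor p,
    so that the valuations of the terms increase and the last one dominates. *)
Lemma kappa_valuation (i : 'Z_n) :
  kappa p q i != 0 /\ V (kappa p q i) = \sum_(1 <= a < n) V (p (i - a%:R)).
Proof.
have n_gt0 : (0 < n)%N by apply: leq_trans n_ge3.
have kterm0 h : kterm p q i h != 0 by rewrite D_dom ?prod_nat_neq0.
have ktermV h : V (kterm p q i h) = \sum_(1 <= a < h.+1) V (p (i - a%:R))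
                      + \sum_(h.+2 <= a < n.+1) V (q (i - a%:R)).
  by rewrite valV.1 ?prod_nat_neq0 // !(valuation_prod_nat valV).
have -> : kappa p q i = \sum_(h < n.-1.+1) kterm p q i h.
  by rewrite kappaE prednK.
have [|h lt_h|S0 ->] := valuation_sum_increasing valV (F := kterm p q i) (k := n.-1).
- by [].
- rewrite !ktermV [\sum_(1 <= a < h.+2) _]big_nat_recr //= -addrA ltrD2l.
  rewrite [\sum_(h.+2 <= a < n.+1) _]big_ltn; last by lia.
  by rewrite ltrD2r.
split=> //; rewrite ktermV prednK // [X in _ + X]big_geq ?addr0 //.
Qed.

Lemma p_image_valuation i :
  V (p_image p q i) = V (p i) + V (q i) - V (p (i + 1)).
Proof.
have [k0 kV] := kappa_valuation i; have [k10 k1V] := kappa_valuation (i + 1).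
have kV0 : (kappa p q i)^-1 != 0.
  by apply: contraNneq k0 => kV0; rewrite -[kappa p q i]invrK kV0 invr0.
rewrite /p_image !valV.1 ?D_dom // valuationV // kV k1V.
have := cyclic_sum_shift n_ge3 (fun k => V (p k)) i; lia.
Qed.

Lemma q_image_valuation i : V (q_image p q i) = V (p (i + 1)).
Proof.
have [k0 kV] := kappa_valuation i; have [k10 k1V] := kappa_valuation (i + 1).
have kV0 : (kappa p q (i + 1))^-1 != 0.
  by apply: contraNneq k10 => kV0; rewrite -[kappa p q _]invrK kV0 invr0.
rewrite /q_image !valV.1 ?D_dom // valuationV // kV k1V.
have := cyclic_sum_shift n_ge3 (fun k => V (p k)) i; lia.
Qed.
End KappaValuation.

(** * The R-matrix morphism *)
Section RMatrixMorphism.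
Variables (n m : nat) (D : unitRingType).
Hypothesis n_ge3 : (2 < n)%N.
Local Notation T := (quantum_torus n m).
Local Notation qindex := (qindex n m).
Variable iota : {rmorphism T -> D}.
Hypothesis hD : skew_field_of_fractions iota.
Variables j j1 : 'I_m.
Hypothesis hj : j1 = j.+1 :> nat.

Local Notation eps := (iota torus_eps).
Local Notation q := (fun l i => iota (torus_q l i)).
Local Notation q' := (R_image q j j1).

Let ne_j : j1 != j.
Proof. by rewrite -(inj_eq val_inj) /= hj neq_ltn ltnSn orbT. Qed.

Let lt_j : (j < j1)%N. Proof. by rewrite hj. Qed.

Lemma q_unit l i : q l i \is a GRing.unit.
Proof. exact: (torus_gen_unit iota (Some (l, i))). Qed.

Lemma q_neq0 l i : q l i != 0.
Proof. by rewrite (iota_neq0 hD); exact: (torus_gen_neq0 hD (Some (l, i))). Qed.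

Lemma q_qcommute (x y : qindex) :
  qcommute eps (q x.1 x.2) (q y.1 y.2) (qexponent x y).
Proof.
exact: (iffLR (commutation_relationsP n_ge3 q (eps_unit iota))
  (torus_commutation iota) x y).
Qed.

(** Giving weight 1 to row [j] and 0 to the others separates the terms of kappa by
    their valuations, so that kappa is nonzero. *)
Lemma kappa_unit i : kappa (q j) (q j1) i \is a GRing.unit.
Proof.
have [V [valV Vq _]] := weight_valuation hD (fun x => (x.1 == j)%:R).
apply: (D_unit hD); apply: (kappa_valuation valV (D_mulf_neq0 hD) n_ge3 _ _ _ i).1.
- by move=> k; exact: q_neq0.
- by move=> k; exact: q_neq0.
- by move=> k l; rewrite (Vq (j1, k)) (Vq (j, l)) /= eqxx (negPf ne_j).
Qed.

Lemma R_image_low i : q' j i = p_image (q j) (q j1) i.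
Proof. by rewrite /R_image eqxx. Qed.

Lemma R_image_high i : q' j1 i = q_image (q j) (q j1) i.
Proof. by rewrite /R_image (negPf ne_j) eqxx. Qed.

Lemma R_image_other l i : l != j -> l != j1 -> q' l i = q l i.
Proof. by move=> lj lj1; rewrite /R_image (negPf lj) (negPf lj1). Qed.

Lemma qexponent_row (l : 'I_m) (i k : 'Z_n) :
  qexponent ((l, i) : qindex) (l, k) = row_exponent (i - k).
Proof. by rewrite /qexponent /snake_index /= eqxx; congr row_exponent; ring. Qed.

Lemma qexponent_adjacent (i k : 'Z_n) :
  qexponent ((j, i) : qindex) (j1, k) = step_exponent (i - k).
Proof.
rewrite /qexponent /snake_index /= eq_sym (negPf ne_j) lt_j hj -(@natr1 _ j.+1).
rewrite /step_exponent; have -> : i + j.+1%:R - (k + (j.+1%:R + 1)) = i - k - 1 by ring.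
have -> : i - k - 1 - 1 = i - k - 2 by ring.
by rewrite subrK.
Qed.

Lemma qexponent_other (l : 'I_m) (i k : 'Z_n) : l != j -> l != j1 ->
  qexponent ((l, i) : qindex) (j1, k) = qexponent (l, i) (j, k + 1).
Proof.
move=> lj lj1; rewrite /qexponent /snake_index /= (negPf lj) (negPf lj1).
have -> : (l < j1)%N = (l < j)%N.
  by rewrite hj ltnS leq_eqVlt (inj_eq val_inj) (negPf lj).
have -> // : i + l.+1%:R - (k + j1.+1%:R) = i + l.+1%:R - (k + 1 + j.+1%:R) :> 'Z_n.
by rewrite hj -(@natr1 _ j.+1); ring.
Qed.

Lemma R_image_unit l i : q' l i \is a GRing.unit.
Proof.
rewrite /R_image; case: ifP => _.
  by rewrite !unitrMl ?unitrV ?kappa_unit ?q_unit.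
by case: ifP => _; rewrite ?q_unit // !unitrMl ?unitrV ?kappa_unit ?q_unit.
Qed.

Let eps_u := eps_unit iota.
Let eps_c := eps_central hD.

Let qpp i k : qcommute eps (q j i) (q j k) (row_exponent (i - k)).
Proof. by rewrite -(qexponent_row j); exact: (q_qcommute (j, i) (j, k)). Qed.
Let qqq i k : qcommute eps (q j1 i) (q j1 k) (row_exponent (i - k)).
Proof. by rewrite -(qexponent_row j1); exact: (q_qcommute (j1, i) (j1, k)). Qed.
Let qpq i k : qcommute eps (q j i) (q j1 k) (step_exponent (i - k)).
Proof. by rewrite -qexponent_adjacent; exact: (q_qcommute (j, i) (j1, k)). Qed.

Lemma R_image_other_qcommute l i y : l != j -> l != j1 ->
  qcommute eps (q l i) (q' y.1 y.2) (qexponent (l, i) y).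
Proof.
case: y => [l' k] lj lj1 /=.
have r_p a : qcommute eps (q l i) (q j a) (qexponent (l, i) (j, a)).
  exact: (q_qcommute (l, i) (j, a)).
have r_q a : qcommute eps (q l i) (q j1 a) (qexponent (l, i) (j, a + 1)).
  by rewrite -qexponent_other //; exact: (q_qcommute (l, i) (j1, a)).
have [->|l'j] := eqVneq l' j.
  rewrite R_image_low.
  exact: (other_p_image eps_u eps_c n_ge3 kappa_unit
    (E := fun a => qexponent (l, i) (j, a)) r_p r_q).
have [->|l'j1] := eqVneq l' j1.
  rewrite R_image_high qexponent_other //.
  exact: (other_q_image eps_u eps_c n_ge3 kappa_unit
    (E := fun a => qexponent (l, i) (j, a)) r_p r_q).
by rewrite R_image_other //; exact: (q_qcommute (l, i) (l', k)).
Qed.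

Lemma R_image_qcommute (x y : qindex) :
  qcommute eps (q' x.1 x.2) (q' y.1 y.2) (qexponent x y).
Proof.
have other_l (z t : qindex) : z.1 != j -> z.1 != j1 ->
    qcommute eps (q' z.1 z.2) (q' t.1 t.2) (qexponent z t).
  by case: z => l i /= lj lj1; rewrite R_image_other //; exact: R_image_other_qcommute.
have sym_to (z t : qindex) :
    qcommute eps (q' z.1 z.2) (q' t.1 t.2) (qexponent z t) ->
    qcommute eps (q' t.1 t.2) (q' z.1 z.2) (qexponent t z).
  by move=> /(qcommute_sym eps_u); rewrite -qexponent_anti.
have jj1 i k : qcommute eps (q' j i) (q' j1 k) (qexponent (j, i) (j1, k)).
  rewrite R_image_low R_image_high qexponent_adjacent.
  exact: (p_image_q_image eps_u eps_c n_ge3 (q_unit j1) qpp qqq qpq kappa_unit).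
have row (l : 'I_m) : (l == j) || (l == j1) \/ (l != j) /\ (l != j1).
  by case: (l == j); case: (l == j1); auto.
case: (row x.1) => [xj|[]]; last exact: other_l.
case: (row y.1) => [yj|[yj yj1]]; last by apply/sym_to/other_l.
case: x y xj yj => [l i] [l' k] /= /orP[] /eqP -> /orP[] /eqP ->.
- rewrite !R_image_low qexponent_row.
  exact: (p_image_p_image eps_u eps_c n_ge3 (q_unit j1) qpp qqq qpq kappa_unit).
- exact: jj1.
- exact: (sym_to (j, k) (j1, i) (jj1 k i)).
- rewrite !R_image_high qexponent_row.
  exact: (q_image_q_image eps_u eps_c n_ge3 (q_unit j1) qpp qqq qpq kappa_unit).
Qed.

Lemma R_image_commutation : commutation_relations eps q'.
Proof. exact: (iffRL (commutation_relationsP n_ge3 q' eps_u) R_image_qcommute). Qed.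

Lemma R_torus_morphism : exists phi : {rmorphism T -> D},
  phi torus_eps = eps /\ forall l i, phi (torus_q l i) = q' l i.
Proof.
(* The letters with flag true must go to the inverses. *)
pose base u : D := if u is Some x then q' x.1 x.2 else eps.
have base_u u : base u \is a GRing.unit by case: u => [x|]; [exact: R_image_unit|].
have [||||phi phiE] := @torus_lift n m D
   (fun x => if x.2 then (base x.1)^-1 else base x.1).
- by move=> u /=; rewrite mulrV.
- by move=> u /=; rewrite mulVr.
- by move=> x; exact: eps_c.
- move=> x y e xye /=; rewrite (R_image_commutation xye); congr (_ * _).
  by case: e {xye} => k; rewrite // exprVn.
exists phi; split; first exact: (phiE None false).
by move=> l i; exact: (phiE (Some (l, i)) false).
Qed.

(** In the normal form of [x], keep the monomials whose coefficients are not zero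
    and choose a weight for which the images of these monomials have distinct
    valuations.  The coefficients are Laurent polynomials in eps and have
    valuation 0. *)
Lemma R_torus_morphism_neq0 (phi : {rmorphism T -> D}) :
  phi torus_eps = eps -> (forall l i, phi (torus_q l i) = q' l i) ->
  forall x, x != 0 -> phi x != 0.
Proof.
move=> phi_eps phi_q x x0; have [A [C [UA CL nf]]] := normal_form n_ge3 hD x.
pose B := [seq a <- A | C a != 0].
have restrict (f : {rmorphism T -> D}) : f torus_eps = eps ->
    f x = \sum_(a <- B) iota (C a) * ordered_monomial f (enum {: qindex}) a.
  move=> feps; rewrite nf // big_filter [RHS]big_mkcond; apply: eq_bigr => a _.
  by case: eqP => //= ->; rewrite rmorph0 mul0r.
have [w [w_lt w_inj]] := separating_weight ne_j B.
have [V [valV Vq VL]] := weight_valuation hD w.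
have D_dom := D_mulf_neq0 hD; have D_un := D_unit hD.
have V_lt i k : V (q j1 i) < V (q j k) by rewrite (Vq (j1, i)) (Vq (j, k)).
have Vq' y : V (q' y.1 y.2) = image_weight j j1 w y.
  case: y => l i; rewrite /image_weight /=; have [->|lj] := eqVneq l j.
    rewrite R_image_low (p_image_valuation valV D_un D_dom n_ge3) //; try exact: q_neq0.
    by rewrite (Vq (j, i)) (Vq (j1, i)) (Vq (j, i + 1)).
  have [->|lj1] := eqVneq l j1.
    rewrite R_image_high (q_image_valuation valV D_un D_dom n_ge3) //; try exact: q_neq0.
    by rewrite (Vq (j, i + 1)).
  by rewrite R_image_other // (Vq (l, i)).
have phi_gen (y : qindex) : phi (torus_gen (Some y) false) = q' y.1 y.2.
  by case: y => l i; exact: phi_q.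
have q'0 (y : qindex) : phi (torus_gen (Some y) false) != 0.
  rewrite phi_gen; apply: contraTneq (R_image_unit y.1 y.2) => ->.
  by rewrite unitr0.
have q'V (y : qindex) : V (phi (torus_gen (Some y) false)) = image_weight j j1 w y.
  by rewrite phi_gen Vq'.
have mono0 a : ordered_monomial phi (enum {: qindex}) a != 0 /\
    V (ordered_monomial phi (enum {: qindex}) a)
    = \sum_y a y * image_weight j j1 w y.
  have [m0 mV] := valuation_prodX valV D_un D_dom (enum {: qindex}) a q'0.
  split=> //; rewrite /ordered_monomial mV big_enum.
  by apply: eq_bigr => y _; rewrite q'V.
have C0 a : a \in B -> C a != 0 by rewrite mem_filter => /andP[].
have iC0 a : a \in B -> iota (C a) != 0 by move=> /C0; rewrite (iota_neq0 hD).
have V_term a : a \in B ->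
    V (iota (C a) * ordered_monomial phi (enum {: qindex}) a)
    = \sum_y a y * image_weight j j1 w y.
  move=> aB; have [m0 mV] := mono0 a.
  by rewrite (valV.1 _ _ (iC0 _ aB) m0) mV (VL _ (CL a) (C0 _ aB)) add0r.
rewrite restrict //; apply: (valuation_sum_neq0 valV).
- exact: filter_uniq.
- by move=> a aB; apply: D_dom; [exact: iC0 | exact: (mono0 a).1].
- by move=> a b aB bB; rewrite !V_term //; exact: w_inj.
- rewrite lt0n size_eq0; apply: contraNneq x0 => B0.
  by rewrite -[x == 0]negbK -(iota_neq0 hD) restrict // B0 big_nil eqxx.
Qed.

Lemma R_morphism : exists R : {rmorphism D -> D},
  [/\ R eps = eps, forall l i, R (q l i) = q' l i
    & forall R' : {rmorphism D -> D},
        R' eps = eps -> (forall l i, R' (q l i) = q' l i) -> R' =1 R].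
Proof.
have [phi [phi_eps phi_q]] := R_torus_morphism.
have [R RE] := extend_morphism hD (R_torus_morphism_neq0 phi_eps phi_q).
exists R; split=> [|l i|R' R'eps R'q x]; rewrite ?RE //.
have R'E a : R' (iota a) = R (iota a).
  rewrite RE; have [A [C [_ _ nf]]] := normal_form n_ge3 hD a.
  rewrite (nf phi) // -[R' _]/((R' \o iota) a) (nf (R' \o iota)) //.
  apply: eq_bigr => b _; congr (_ * _); apply: eq_bigr => -[l i] _.
  by rewrite -[torus_gen _ _]/(torus_q l i) phi_q /= R'q.
have [a [b [b0 ->]]] := skew_field_frac hD x.
by rewrite !rmorphM !rmorphV ?iota_unit // !R'E.
Qed.
End RMatrixMorphism.

Theorem theorem5p2 (n m : nat) (hn : (3 <= n)%N) (hm : (2 <= m)%N)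
    (D : unitRingType) (iota : {rmorphism quantum_torus n m -> D})
    (hD : skew_field_of_fractions iota)
    (j j1 : 'I_m) (hj : j1 = j.+1 :> nat) :
  let eps : D := iota torus_eps in
  let q : 'I_m -> 'Z_n -> D := fun l i => iota (torus_q l i) in
  let q' : 'I_m -> 'Z_n -> D := R_image q j j1 in
  (exists R : {rmorphism D -> D},
      [/\ R eps = eps,
          forall l i, R (q l i) = q' l i
        & forall R' : {rmorphism D -> D},
            R' eps = eps -> (forall l i, R' (q l i) = q' l i) -> R' =1 R])
  /\ commutation_relations eps q'.
Proof.
by split; [exact: R_morphism | exact: R_image_commutation].
Qed.
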